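(* For all integers $k>n\ge0$ there exists an embedding of $\mathbb{F}_n$ as a rational scroll of degree $2k-n$ in $\mathbb{P}^{2k-n+1}$.
   Context: Everything is over $\mathbb{C}$. $\mathbb{F}_n=\mathbb{P}_{\mathbb{P}^1}(\mathcal{O}_{\mathbb{P}^1}\oplus\mathcal{O}_{\mathbb{P}^1}(-n))$, a $\mathbb{P}^1$-bundle over $\mathbb{P}^1$. An embedded geometrically ruled surface $S=\mathbb{P}_C(\mathcal{E})\subseteq\mathbb{P}^N$ (the projectivization of a rank 2 vector bundle $\mathcal{E}$ over a smooth projective curve $C$, embedded in $\mathbb{P}^N$) is called a scroll if every fibre of $S\to C$ has degree 1 in $\mathbb{P}^N$; it is a rational scroll when $C\simeq\mathbb{P}^1$. *)

(* Defs.v *)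
From HB Require Import structures.
From mathcomp Require Import all_boot all_order all_algebra.
From mathcomp Require Import mpoly.
From mathcomp Require Export complex.
From mathcomp Require Import boolp classical_sets.
From mathcomp Require Export reals.

Set Implicit Arguments.
Unset Strict Implicit.
Unset Printing Implicit Defensive.

Import GRing.Theory.
Local Open Scope classical_set_scope.
Local Open Scope ring_scope.

(* Quotient of a type by a relation; a point is an equivalence class. *)
Definition quot (T : Type) (e : T -> T -> Prop) : Type :=
  {A : set T | exists x, A = [set y | e x y]}.

Definition cls (T : Type) (e : T -> T -> Prop) (x : T) : quot e :=
  exist _ [set y | e x y] (ex_intro _ x erefl).

Definition repr (T : Type) (e : T -> T -> Prop) (q : quot e) : T :=
  projT1 (cid (svalP q)).

Lemma cls_repr (T : Type) (e : T -> T -> Prop) (q : quot e) :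
  cls e (repr q) = q.
Proof.
apply: eq_sig_hprop => [B p1 p2|]; first exact: Prop_irrelevance.
by rewrite /repr; case: (cid (svalP q)).
Qed.

Lemma repr_cls (T : Type) (e : T -> T -> Prop) (x : T) :
  (forall y, e y y) -> e x (repr (cls e x)).
Proof.
move=> er; rewrite /repr; case: (cid _) => y /= hy.
have : [set z | e y z] y by apply: er.
by rewrite -hy.
Qed.

Section Varieties.
Variable K : closedFieldType.

(* Varieties are treated as spaces with functions: a topology together with    *)
(* the K-valued functions regular on each open set.  A function regular on U   *)
(* is given by any extension of it to the whole space, so [regular U f] only   *)
(* constrains the restriction of f to U, and is meant for open U.  The record  *)
(* carries no axioms: the instances below are those of classical algebraic     *)
(* geometry.                                                                   *)
Record space := Space {
  point :> Type;
  zopen : set (set point);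
  regular : set point -> (point -> K) -> Prop }.

Definition morphism (X Y : space) (f : X -> Y) : Prop :=
  (forall V, zopen V -> zopen (f @^-1` V)) /\
  (forall V (g : Y -> K),
     zopen V -> regular V g -> regular (f @^-1` V) (g \o f)).

Definition isomorphism (X Y : space) (f : X -> Y) : Prop :=
  morphism f /\ exists g : Y -> X, [/\ morphism g, cancel f g & cancel g f].

Definition isomorphic (X Y : space) : Prop :=
  exists f : X -> Y, isomorphism f.

Definition peval (m : nat) (h : {mpoly K[m]}) (x : 'rV[K]_m) : K := h.@[x 0].

Definition affine_space (m : nat) : space :=
  @Space 'rV[K]_m
    [set U | exists S : set {mpoly K[m]},
       forall x, U x <-> exists2 h, S h & peval h x != 0]
    (fun U f => forall x, U x -> exists g h : {mpoly K[m]}, peval h x != 0 /\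
       forall y, U y -> peval h y != 0 -> f y = peval g y / peval h y).

Definition subspace (X : space) (A : set X) : space :=
  @Space {x | A x}
    [set V | exists2 U : set X, zopen U & V = sval @^-1` U]
    (fun V f => forall a, V a -> exists (U : set X) (g : X -> K),
       [/\ zopen U, U (sval a), regular U g &
           forall b, V b -> U (sval b) -> f b = g (sval b)]).

Definition quotient (X : space) (e : X -> X -> Prop) : space :=
  @Space (quot e)
    [set V | zopen (cls e @^-1` V)]
    (fun V f => regular (cls e @^-1` V) (f \o cls e)).

Definition coprod (I : Type) (X : I -> space) : space :=
  @Space {i : I & X i}
    [set V | forall i, zopen (existT X i @^-1` V)]
    (fun V f => forall i, regular (existT X i @^-1` V) (f \o existT X i)).

(* h is induced by an element of O(U) (x) O(V) *)
Definition tensor (X Y : space) (U : set X) (V : set Y) (h : X * Y -> K) :=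
  exists m (a : 'I_m -> X -> K) (b : 'I_m -> Y -> K),
    [/\ forall i, regular U (a i), forall i, regular V (b i) &
        forall p, h p = \sum_i a i p.1 * b i p.2].

(* The product in the category of spaces with functions: it has more open sets *)
(* than the product topology, a basis being given by the loci h != 0 in U x V  *)
(* for h in O(U) (x) O(V).                                                     *)
Definition product (X Y : space) : space :=
  @Space (X * Y)%type
    [set W | forall p, W p ->
       exists (U : set X) (V : set Y) (h : X * Y -> K),
       [/\ zopen U /\ zopen V, U p.1 /\ V p.2, tensor U V h, h p != 0 &
           forall q, U q.1 -> V q.2 -> h q != 0 -> W q]]
    (fun W f => forall p, W p ->
       exists (U : set X) (V : set Y) (g h : X * Y -> K),
       [/\ zopen U /\ zopen V, U p.1 /\ V p.2, tensor U V g /\ tensor U V h,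
           h p != 0 &
           forall q, W q -> U q.1 -> V q.2 -> h q != 0 -> f q = g q / h q]).

(* The closed subset carries its reduced structure. *)
Definition closed_embedding (X Y : space) (f : X -> Y) : Prop :=
  zopen (~` range f) /\
  isomorphism (fun x => exist _ (f x) (ex_intro2 _ _ x I erefl)
                 : subspace (range f)).

Definition punctured (N : nat) : space :=
  @subspace (affine_space N.+1) [set v | v <> 0].

Definition vec (N : nat) (v : punctured N) : 'rV[K]_N.+1 := sval v.

Definition proportional (N : nat) (v w : punctured N) : Prop :=
  exists2 c : K, c != 0 & vec w = c *: vec v.

Definition proj_space (N : nat) : space := quotient (@proportional N).

(* A rank r bundle is given by gluing data: fibre coordinates over the i-th    *)
(* member of an open cover are row vectors, and those over the j-th one are    *)
(* obtained from them by right multiplication by [trans i j].                  *)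
Record bundle (X : space) (r : nat) := Bundle {
  idx : Type;
  dom : idx -> set X;
  trans : idx -> idx -> X -> 'M[K]_r;
  dom_open : forall i, zopen (dom i);
  dom_cover : forall x, exists i, dom i x;
  trans_regular : forall i j a b,
    regular (dom i `&` dom j) (fun x => trans i j x a b);
  trans_id : forall i x, dom i x -> trans i i x = 1%:M;
  trans_cocycle : forall i j k x, dom i x -> dom j x -> dom k x ->
    trans i j x *m trans j k x = trans i k x }.

Section Projectivization.
Variables (X : space) (r : nat) (E : bundle X r).

Definition nonzero_chart (i : idx E) : space :=
  @subspace (product X (affine_space r)) [set p | dom i p.1 /\ p.2 <> 0].

Definition nonzero_charts : space := coprod nonzero_chart.

Definition base (p : nonzero_charts) : X := (sval (projT2 p)).1.

Definition coords (p : nonzero_charts) : 'rV[K]_r := (sval (projT2 p)).2.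

Definition same_line (p q : nonzero_charts) : Prop :=
  base p = base q /\
  exists2 c : K, c != 0 &
    coords q = c *: (coords p *m trans (projT1 p) (projT1 q) (base p)).

(* P(E) as the space of lines in the fibres of E.  For E of rank 2 the other   *)
(* convention gives the same ruled surface, since E^* = E (x) det(E)^-1.       *)
Definition projectivization : space := quotient same_line.

Definition bundle_proj (z : projectivization) : X := base (repr z).

End Projectivization.

Section Twists.
Variable N : nat.

Definition hcoord (i : 'I_N.+1) (x : proj_space N) : K :=
  vec (repr x) 0 i.

Definition std_open (i : 'I_N.+1) : set (proj_space N) :=
  [set x | hcoord i x != 0].

Definition hratio (i j : 'I_N.+1) (x : proj_space N) : K :=
  hcoord i x / hcoord j x.

(* O(d) is generated on x_i != 0 by x_i ^ d, and s_i x_i ^ d = s_j x_j ^ d     *)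
(* means s_j = s_i (x_i / x_j) ^ d.                                            *)
Definition twist_trans (r : nat) (d : 'I_r -> int) (i j : 'I_N.+1)
    (x : proj_space N) : 'M[K]_r :=
  diag_mx (\row_a hratio i j x ^ d a).

Lemma hcoord_cls (v : punctured N) :
  exists2 c : K, c != 0 &
    forall i, hcoord i (cls (@proportional N) v) =
      c * vec v 0 i.
Proof.
have rf y : @proportional N y y by exists 1; rewrite ?oner_eq0 ?scale1r.
have [c c0 E] := repr_cls v rf.
by exists c => // i; rewrite /hcoord E mxE.
Qed.

Lemma hratio_cls (v : punctured N) (i j : 'I_N.+1) :
  hratio i j (cls (@proportional N) v) =
  vec v 0 i / vec v 0 j.
Proof.
have [c c0 E] := hcoord_cls v.
by rewrite /hratio !E -mulf_div divff // mul1r.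
Qed.

Lemma std_open_cls (v : punctured N) (i : 'I_N.+1) :
  std_open i (cls (@proportional N) v) <-> vec v 0 i != 0.
Proof.
have [c c0 E] := hcoord_cls v.
by rewrite /std_open /= E mulf_eq0 (negbTE c0).
Qed.

Lemma std_open_open i : zopen (std_open i).
Proof.
exists [set v : 'rV[K]_N.+1 | v 0 i != 0].
  exists [set 'X_i] => x /=; split.
    by move=> xi; exists 'X_i => //; rewrite /peval mevalXU.
  by case=> h ->; rewrite /peval mevalXU.
by rewrite predeqE => v; apply: std_open_cls.
Qed.

Lemma std_open_cover x : exists i, std_open i x.
Proof.
rewrite -(cls_repr x); case: (repr x) => v v0.
have /rV0Pn[i vi] : v != 0 by apply/eqP.
by exists i; apply/std_open_cls.
Qed.

Lemma twist_regular r (d : 'I_r -> int) i j a b :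
  regular (std_open i `&` std_open j) (fun x => twist_trans d i j x a b).
Proof.
move=> v [/std_open_cls vi /std_open_cls vj].
pose D := [set w : 'rV[K]_N.+1 | w 0 i != 0 /\ w 0 j != 0].
exists D.
exists (fun w : 'rV[K]_N.+1 => diag_mx (\row_c (w 0 i / w 0 j) ^ d c) a b); split => //.
- exists [set 'X_i * 'X_j] => x /=; split.
    move=> [xi xj]; exists ('X_i * 'X_j) => //.
    by rewrite /peval mevalM !mevalXU mulf_neq0.
  case=> h ->; rewrite /peval mevalM !mevalXU mulf_eq0 negb_or.
  by move/andP.
- move=> w [wi wj]; have [ab|ab] := boolP (a == b); last first.
    exists 0, 1; rewrite /peval meval1 oner_eq0; split=> // y _ _ /=.
    by rewrite !mxE (negbTE ab) mulr0n meval0 mul0r.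
  case da: (d b) => [m|m].
    exists ('X_i ^+ m), ('X_j ^+ m); split.
      by rewrite /peval rmorphXn /= mevalXU expf_neq0.
    move=> y _ _ /=; rewrite !mxE ab /peval !rmorphXn /= !mevalXU mulr1n.
    by rewrite (eqP ab) da -exprnP expr_div_n.
  exists ('X_j ^+ m.+1), ('X_i ^+ m.+1); split.
    by rewrite /peval rmorphXn /= mevalXU expf_neq0.
  move=> y _ _ /=; rewrite !mxE ab /peval !rmorphXn /= !mevalXU mulr1n.
  by rewrite (eqP ab) da NegzE -exprnN expr_div_n invf_div.
by move=> w _ _ /=; rewrite /twist_trans !mxE hratio_cls.
Qed.

Lemma twist_id r (d : 'I_r -> int) i x :
  std_open i x -> twist_trans d i i x = 1%:M.
Proof.
move=> xi; apply/matrixP=> a b; rewrite !mxE /hratio divff //.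
by rewrite exp1rz.
Qed.

Lemma twist_cocycle r (d : 'I_r -> int) i j k x :
  std_open i x -> std_open j x -> std_open k x ->
  twist_trans d i j x *m twist_trans d j k x = twist_trans d i k x.
Proof.
move=> xi xj xk; rewrite /twist_trans mulmx_diag; congr diag_mx.
apply/rowP=> a; rewrite !mxE -exprMz_comm; last exact: mulrC.
  by rewrite /hratio mulrA divfK.
all: by rewrite unitfE mulf_neq0 // invr_eq0.
Qed.

(* The direct sum over a of the line bundles O(d a) on P^N. *)
Definition sum_twists (r : nat) (d : 'I_r -> int) : bundle (proj_space N) r :=
  Bundle std_open_open std_open_cover (twist_regular d) (@twist_id r d)
    (@twist_cocycle r d).

End Twists.

Definition hirzebruch_bundle (n : nat) : bundle (proj_space 1) 2 :=
  sum_twists 1 (fun a : 'I_2 => if a == 0 then 0 else - n%:Z).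

Definition hirzebruch (n : nat) : space :=
  projectivization (hirzebruch_bundle n).

(* [hilbert_function Z m h]: the degree m part of the homogeneous coordinate   *)
(* ring of Z has dimension h; V is the degree m part of the ideal of Z.        *)
Definition hilbert_function (N : nat) (Z : set (proj_space N)) (m h : nat) :=
  exists V : {vspace dhomog N.+1 K m},
    (forall p : dhomog N.+1 K m, p \in V <->
       forall v : punctured N, Z (cls (@proportional N) v) ->
         peval p (vec v) = 0) /\
    h = (\dim {: dhomog N.+1 K m} - \dim V)%N.

(* The degree is r! times the leading coefficient of the Hilbert polynomial,   *)
(* where r is the degree of that polynomial, i.e. the dimension of Z.          *)
Definition has_degree (N : nat) (Z : set (proj_space N)) (d : nat) : Prop :=
  exists P : {poly rat},
    (exists m0, forall m, (m0 <= m)%N ->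
       exists2 h, hilbert_function Z m h & P.[m%:R] = h%:R) /\
    lead_coef P * ((size P).-1)`!%:R = d%:R.

Definition scroll (C : space) (E : bundle C 2) (N : nat)
    (phi : projectivization E -> proj_space N) : Prop :=
  closed_embedding phi /\
  forall c : C, has_degree (phi @` [set z | bundle_proj z = c]) 1.

(* C isomorphic to P^1 subsumes C being a smooth projective curve. *)
Definition rational_scroll (C : space) (E : bundle C 2) (N : nat)
    (phi : projectivization E -> proj_space N) : Prop :=
  isomorphic C (proj_space 1) /\ scroll phi.

End Varieties.

(* Main.v *)
Require Import Defs.
From HB Require Import structures.
From mathcomp Require Import all_boot all_order all_algebra.
From mathcomp Require Import mpoly complex.
From mathcomp Require Import boolp classical_sets reals.
From mathcomp Require Import zify ring.

(* Let x_0, x_1 be homogeneous coordinates on P^1 and y_0, y_1 coordinates on *)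
(* the fibres of O and O(-n), so that y_1 has degree -n in x.  The products   *)
(* y_0 x_0^(k-n-l) x_1^l and y_1 x_0^(k-l) x_1^l are homogeneous of the same  *)
(* degree in x and linear in y, hence define a map from F_n to P^(2k-n+1).    *)
(* Its image is cut out by the 2 x 2 minors of the matrix whose columns are   *)
(* the consecutive pairs of coordinates with the same y.  Where a coordinate  *)
(* y_e x_j^d of maximal degree in x_j is nonzero, the ratio x_0 : x_1 is read *)
(* off that coordinate and its neighbour and y off the two coordinates        *)
(* y_0 x_j^(k-n) and y_1 x_j^k, so the inverse is a morphism; k > n ensures   *)
(* that the neighbour exists.  The degree m forms on the image correspond to  *)
(* the monomials of degree i and m - i in y_0, y_1 and of degree              *)
(* i(k-n) + (m-i)k in x, whose number is (2k-n) m(m+1)/2 + m + 1, and on a    *)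
(* fibre to the m + 1 monomials of degree m in y_0, y_1.                      *)

Set Implicit Arguments.
Unset Strict Implicit.
Unset Printing Implicit Defensive.

Import GRing.Theory Num.Theory.
Local Open Scope classical_set_scope.
Local Open Scope ring_scope.

(** Put A = k - n and B = k. The map is given by the sections y_0 f and y_1 g, with f and g binary
    forms of degrees A and B; in coordinates it is [scroll_vec], and its image is the rational
    normal scroll S(A, B): two rational normal curves of degrees A and B in complementary subspaces,
    with corresponding points joined by lines. The twist by -n in the gluing of F_n is what makes
    both blocks of coordinates change by the same factor from chart to chart ([scroll_map_line]), so
    that a point of P^(A+B+1) results.

    Closedness of the image is [minors_scroll_vec]: a nonzero column of the matrix determines x_0 :
    x_1, and each block is then a geometric progression in that ratio. The image is covered by the
    four open sets on which an end coordinate of a block is nonzero ([scroll_map_corner]), and on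
    each of them [scroll_map_inv] is a morphism inverting the map; this gives injectivity and
    regularity of the inverse. As [space] carries no axioms, such local arguments rest on the
    conditions [nice], which all constructions preserve.

    Degrees come from Hilbert functions. Pulling a form back along a monomial parametrization sends
    monomials to multiples of monomials, so the Hilbert function counts the monomials that are hit
    ([hilbert_function_monomial]). A fibre yields m + 1, the Hilbert polynomial of a line; the
    scroll yields a quadratic polynomial with leading coefficient (A + B)/2, hence degree A + B = 2k
    - n. *)

Section SpacesWithFunctions.
Variable K : closedFieldType.
Implicit Types X Y Z : Defs.space K.

(** * Sheaf and local ring conditions on spaces with functions *)

Definition locally X (W : set X) (P : set X -> Prop) : Prop :=
  forall x, W x -> exists U : set X, [/\ zopen U, U x & P U].

(* The sheaf and local ring conditions that the record [space] leaves out. *)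
Record nice X : Prop := Nice {
  nice_openT : zopen (setT : set X);
  nice_openI : forall U V : set X, zopen U -> zopen V -> zopen (U `&` V);
  nice_open_local : forall W : set X, locally W (fun U => U `<=` W) -> zopen W;
  nice_regular_local : forall (W : set X) f, zopen W ->
    locally W (fun U => exists2 g, regular U g &
                         forall x, W x -> U x -> f x = g x) -> regular W f;
  nice_cst : forall (U : set X) c, zopen U -> regular U (fun=> c);
  nice_add : forall (U : set X) f g, zopen U -> regular U f -> regular U g ->
    regular U (fun x => f x + g x);
  nice_mul : forall (U : set X) f g, zopen U -> regular U f -> regular U g ->
    regular U (fun x => f x * g x);
  nice_openD : forall (U : set X) f, zopen U -> regular U f ->
    zopen (U `&` [set x | f x != 0]);
  nice_inv : forall (U : set X) f, zopen U -> regular U f ->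
    (forall x, U x -> f x != 0) -> regular U (fun x => (f x)^-1) }.

(** A section over an open set is represented by an arbitrary extension to the whole space; the
    sheaf condition, applied to a single neighbourhood, shows that values off [V] do not matter. *)
Lemma nice_regular_eq X (U V : set X) f g : nice X -> zopen U -> zopen V ->
  V `<=` U -> (forall x, V x -> f x = g x) -> regular U f -> regular V g.
Proof.
move=> nX oU oV sVU efg rf; apply: (nice_regular_local nX oV) => x Vx.
exists U; split => //; first exact: sVU.
by exists f => // y Vy _; rewrite efg.
Qed.

Lemma nice_regularS X (U V : set X) f : nice X -> zopen U -> zopen V ->
  V `<=` U -> regular U f -> regular V f.
Proof. by move=> nX oU oV sVU; apply: nice_regular_eq. Qed.

Lemma nice_exp X (U : set X) f m : nice X -> zopen U -> regular U f ->
  regular U (fun x => f x ^+ m).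
Proof.
move=> nX oU rf; elim: m => [|m IH].
  by under eq_fun do rewrite expr0; apply: nice_cst.
by under eq_fun do rewrite exprS; apply: nice_mul.
Qed.

Lemma nice_div X (U : set X) f g : nice X -> zopen U -> regular U f ->
  regular U g -> (forall x, U x -> g x != 0) -> regular U (fun x => f x / g x).
Proof. by move=> nX oU rf rg g0; apply: nice_mul => //; apply: nice_inv. Qed.

Lemma nice_sum X (U : set X) (I : Type) (s : seq I) (f : I -> X -> K) :
  nice X -> zopen U -> (forall i, regular U (f i)) ->
  regular U (fun x => \sum_(i <- s) f i x).
Proof.
move=> nX oU rf; elim: s => [|i s IH].
  by under eq_fun do rewrite big_nil; apply: nice_cst.
by under eq_fun do rewrite big_cons; apply: nice_add.
Qed.

Lemma nice_prod X (U : set X) (I : Type) (s : seq I) (f : I -> X -> K) :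
  nice X -> zopen U -> (forall i, regular U (f i)) ->
  regular U (fun x => \prod_(i <- s) f i x).
Proof.
move=> nX oU rf; elim: s => [|i s IH].
  by under eq_fun do rewrite big_nil; apply: nice_cst.
by under eq_fun do rewrite big_cons; apply: nice_mul.
Qed.

(** * The constructions of the definitions preserve niceness *)

(** For the converse, [S] can be taken to be all polynomials whose nonvanishing locus lies in
    [W]. *)
Lemma zopen_affineP m (W : set (affine_space K m)) :
  zopen W <-> forall x, W x -> exists2 h, peval h x != 0 &
    forall y : 'rV_m, peval h y != 0 -> W y.
Proof.
split=> [[S SW] x /SW[h Sh hx]|W_loc].
  by exists h => // y hy; apply/SW; exists h.
exists [set h | forall y : 'rV_m, peval h y != 0 -> W y] => x.
by split=> [/W_loc[h hx hW]|[h hW hx]]; [exists h|apply: hW].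
Qed.

Lemma nice_affine m : nice (affine_space K m).
Proof.
have pevalM (g h : {mpoly K[m]}) x : peval (g * h) x = peval g x * peval h x.
  exact: mevalM.
have pevalD (g h : {mpoly K[m]}) x : peval (g + h) x = peval g x + peval h x.
  exact: mevalD.
split.
- by apply/zopen_affineP => x _; exists 1; rewrite /peval ?meval1 ?oner_eq0.
- move=> U V /zopen_affineP oU /zopen_affineP oV; apply/zopen_affineP => x.
  move=> [/oU[g gx gU] /oV[h hx hV]]; exists (g * h).
    by rewrite pevalM mulf_neq0.
  by move=> y; rewrite pevalM mulf_eq0 negb_or => /andP[/gU ? /hV].
- move=> W locW; apply/zopen_affineP => x /locW[U [/zopen_affineP oU Ux UW]].
  by have [h hx hU] := oU _ Ux; exists h => // y /hU/UW.
- move=> W f _ locW x Wx; have [U [/zopen_affineP oU Ux [g rg fg]]] :=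
    locW _ Wx.
  have [a [b [bx gab]]] := rg _ Ux; have [h hx hU] := oU _ Ux.
  (* The factor [h] confines the nonvanishing locus of the denominator to [U], where [f] agrees with
     [g]. *)
  exists (a * h), (b * h); rewrite !pevalM mulf_neq0 //; split => // y Wy.
  rewrite !pevalM mulf_eq0 negb_or => /andP[b0 h0].
  have Uy := hU _ h0.
  by rewrite (fg _ Wy Uy) (gab _ Uy b0) -mulf_div divff // mulr1.
- move=> U c _ x _; exists c%:MP, 1; rewrite /peval meval1 oner_eq0.
  by split => // y _ _; rewrite mevalC meval1 divr1.
- move=> U f g _ rf rg x Ux; have [a [b [b0 fab]]] := rf _ Ux.
  have [c [d [d0 gcd]]] := rg _ Ux.
  exists (a * d + c * b), (b * d); rewrite !pevalM mulf_neq0 //;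
    split=> // y Uy.
  rewrite pevalD !pevalM mulf_eq0 negb_or => /andP[by0 dy0].
  by rewrite fab // gcd // addf_div.
- move=> U f g _ rf rg x Ux; have [a [b [b0 fab]]] := rf _ Ux.
  have [c [d [d0 gcd]]] := rg _ Ux.
  exists (a * c), (b * d); rewrite !pevalM mulf_neq0 //; split=> // y Uy.
  rewrite !pevalM mulf_eq0 negb_or => /andP[by0 dy0].
  by rewrite fab // gcd // mulf_div.
- move=> U f /zopen_affineP oU rf; apply/zopen_affineP => x [Ux /= fx].
  have [h hx hU] := oU _ Ux; have [a [b [b0 fab]]] := rf _ Ux.
  (* Nonvanishing of [h] gives membership in [U], that of [b] the formula [a / b] for [f], and that
     of [a] then gives [f y != 0]. *)
  exists (a * b * h).
    rewrite !pevalM !mulf_neq0 //; apply: contraNneq fx => a0.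
    by rewrite fab // a0 mul0r.
  move=> y; rewrite !pevalM !mulf_eq0 !negb_or => /andP[/andP[a1 b1] /hU Uy].
  by split => //=; rewrite fab // mulf_neq0 // invr_eq0.
- move=> U f _ rf f0 x Ux; have [a [b [b0 fab]]] := rf _ Ux.
  have ax (y : 'rV_m) : U y -> peval b y != 0 -> peval a y != 0.
    move=> Uy bny; apply: contraNneq (f0 _ Uy) => a0.
    by rewrite fab // a0 mul0r.
  (* The fraction is not reduced to [b / a]: the formula for [f] holds only where [b] is nonzero, so
     [b] stays in the denominator. *)
  exists (b * b), (a * b); rewrite !pevalM mulf_neq0 ?ax //; split=> // y Uy.
  rewrite !pevalM mulf_eq0 negb_or => /andP[a1 b1].
  by rewrite fab // invf_div -mulf_div divff // mulr1.
Qed.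

Lemma regular_peval m (p : {mpoly K[m]}) :
  regular (setT : set (affine_space K m)) (peval p).
Proof.
move=> x _; exists p, 1; rewrite /peval meval1 oner_eq0.
by split=> // y _ _; rewrite meval1 divr1.
Qed.

Lemma regular_coord m (i : 'I_m) :
  regular (setT : set (affine_space K m)) (fun x : 'rV_m => x 0 i).
Proof.
have -> : (fun x : 'rV[K]_m => x 0 i) = peval 'X_i.
  by apply/funext => x; rewrite /peval mevalXU.
exact: regular_peval.
Qed.

(** The open set of [X] inducing [W] is the union of all open sets whose trace lies in [W]. *)
Lemma zopen_subspaceP X (A : set X) (W : set (subspace A)) : nice X ->
  (forall a, W a -> exists U : set X,
     [/\ zopen U, U (sval a) & forall b, U (sval b) -> W b]) -> zopen W.
Proof.
move=> nX locW.
exists [set x | exists U : set X,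
  [/\ zopen U, U x & forall b : subspace A, U (sval b) -> W b]].
  apply: (nice_open_local nX) => x [U [oU Ux UW]]; exists U; split=> // y Uy.
  by exists U.
rewrite predeqE => a; split=> [/locW[U [oU Ua UW]]|[U [_ Ua UW]]];
  last exact: UW.
by exists U.
Qed.

Lemma nice_subspace X (A : set X) : nice X -> nice (subspace A).
Proof.
move=> nX; split.
- by exists setT => //; apply: nice_openT.
- move=> _ _ [U oU ->] [V oV ->]; exists (U `&` V) => //; exact: nice_openI.
- move=> W locW; apply: zopen_subspaceP => // a /locW[_ [[U oU ->] Ua UW]].
  by exists U; split => // b /UW.
- move=> W f _ locW a Wa; have [_ [[U oU ->] Ua [g rg fg]]] := locW _ Wa.
  have [V [h [oV Va rh gh]]] := rg _ Ua.
  exists (U `&` V), h; split=> //; first exact: nice_openI.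
    by apply: nice_regularS rh => //; exact: nice_openI.
  by move=> b Wb [Ub Vb]; rewrite fg // gh.
- move=> U c _ a _; exists setT, (fun=> c); split=> //; first exact: nice_openT.
  by apply: nice_cst => //; apply: nice_openT.
- move=> W f g _ rf rg a Wa; have [U [f' [oU Ua rf' ff']]] := rf _ Wa.
  have [V [g' [oV Va rg' gg']]] := rg _ Wa.
  have oUV := nice_openI nX oU oV.
  exists (U `&` V), (fun x => f' x + g' x); split=> //.
    by apply: nice_add => //; [move: rf'|move: rg'];
      apply: nice_regularS => // ? [].
  by move=> b Wb [Ub Vb]; rewrite ff' // gg'.
- move=> W f g _ rf rg a Wa; have [U [f' [oU Ua rf' ff']]] := rf _ Wa.
  have [V [g' [oV Va rg' gg']]] := rg _ Wa.
  have oUV := nice_openI nX oU oV.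
  exists (U `&` V), (fun x => f' x * g' x); split=> //.
    by apply: nice_mul => //; [move: rf'|move: rg'];
      apply: nice_regularS => // ? [].
  by move=> b Wb [Ub Vb]; rewrite ff' // gg'.
- move=> _ f [U oU ->] rf; apply: zopen_subspaceP => // a [Ua /= fa].
  have [V [g [oV Va rg fg]]] := rf _ Ua.
  exists (U `&` (V `&` [set x | g x != 0])); split.
  + by apply: nice_openI => //; apply: nice_openD.
  + by split=> //; split=> //=; rewrite -fg.
  + by move=> b [Ub [Vb /= gb]]; split=> //=; rewrite fg.
- move=> _ f [U oU ->] rf f0 a Ua; have [V [g [oV Va rg fg]]] := rf _ Ua.
  exists (V `&` [set x | g x != 0]), (fun x => (g x)^-1).
  have oW := nice_openD nX oV rg.
  split=> //.
  + by split=> //=; rewrite -fg //; apply: f0.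
  + apply: nice_inv => //; last by move=> x [].
    by apply: nice_regularS rg => // x [].
  + by move=> b Ub [Vb _]; rewrite fg.
Qed.

Lemma nice_quotient X (e : X -> X -> Prop) : nice X -> nice (quotient e).
Proof.
move=> nX; split.
- exact: (nice_openT nX).
- by move=> U V; apply: (nice_openI nX).
- move=> W locW; apply: (nice_open_local nX) => x Wx.
  have [U [oU Ux UW]] := locW _ Wx.
  by exists (cls e @^-1` U); split => // y /UW.
- move=> W f oW locW; apply: (nice_regular_local nX) => // x Wx.
  have [U [oU Ux [g rg fg]]] := locW _ Wx.
  exists (cls e @^-1` U); split=> //; exists (g \o cls e) => // y Wy Uy.
  exact: fg.
- by move=> U c; apply: (nice_cst nX).
- by move=> U f g oU rf rg; apply: (nice_add nX oU rf rg).
- by move=> U f g oU rf rg; apply: (nice_mul nX oU rf rg).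
- by move=> U f oU rf; apply: (nice_openD nX oU rf).
- by move=> U f oU rf f0; apply: (nice_inv nX oU rf) => x Ux; apply: f0.
Qed.

Lemma nice_coprod (I : Type) (X : I -> Defs.space K) :
  (forall i, nice (X i)) -> nice (coprod X).
Proof.
move=> nX; split.
- by move=> i; apply: (nice_openT (nX i)).
- by move=> U V oU oV i; apply: (nice_openI (nX i)).
- move=> W locW i; apply: (nice_open_local (nX i)) => x Wx.
  have [U [oU Ux UW]] := locW _ Wx.
  by exists (existT X i @^-1` U); split => // y /UW.
- move=> W f oW locW i; apply: (nice_regular_local (nX i)) => // x Wx.
  have [U [oU Ux [g rg fg]]] := locW _ Wx.
  exists (existT X i @^-1` U); split=> //;
    exists (g \o existT X i) => // y Wy Uy.
  exact: fg.
- by move=> U c oU i; apply: (nice_cst (nX i)).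
- by move=> U f g oU rf rg i; apply: (nice_add (nX i) (oU i) (rf i) (rg i)).
- by move=> U f g oU rf rg i; apply: (nice_mul (nX i) (oU i) (rf i) (rg i)).
- by move=> U f oU rf i; apply: (nice_openD (nX i) (oU i) (rf i)).
- by move=> U f oU rf f0 i; apply: (nice_inv (nX i) (oU i) (rf i)) => x Ux;
    apply: f0.
Qed.

Section Product.
Variables (X Y : Defs.space K) (nX : nice X) (nY : nice Y).

(** Arbitrary finite index types let sums and products of tensors be indexed by disjoint unions and
    products of types. *)
Lemma tensor_fin (I : finType) (U : set X) (V : set Y) (a : I -> X -> K)
    (b : I -> Y -> K) (h : X * Y -> K) :
  (forall i, regular U (a i)) -> (forall i, regular V (b i)) ->
  (forall p, h p = \sum_i a i p.1 * b i p.2) -> tensor U V h.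
Proof.
move=> ra rb hE; exists #|I|, (a \o enum_val), (b \o enum_val); split=> //.
  by move=> i; apply: ra.
  by move=> i; apply: rb.
by move=> p; rewrite hE (reindex _ (onW_bij _ (@enum_val_bij I))).
Qed.

Lemma tensorS (U U' : set X) (V V' : set Y) h : zopen U -> zopen U' ->
  zopen V -> zopen V' -> U' `<=` U -> V' `<=` V -> tensor U V h ->
    tensor U' V' h.
Proof.
move=> oU oU' oV oV' sU sV [m [a [b [ra rb hE]]]]; exists m, a, b; split=> // i.
- exact: nice_regularS (ra i).
- exact: nice_regularS (rb i).
Qed.

Lemma tensor_add (U : set X) (V : set Y) g h :
  tensor U V g -> tensor U V h -> tensor U V (fun p => g p + h p).
Proof.
move=> [m [a [b [ra rb gE]]]] [m' [a' [b' [ra' rb' hE]]]].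
apply: (@tensor_fin ('I_m + 'I_m')%type U V
  (fun i => match i with inl i => a i | inr i => a' i end)
  (fun i => match i with inl i => b i | inr i => b' i end)).
- by case.
- by case.
- by move=> p; rewrite gE hE big_sumType.
Qed.

Lemma tensor_mul (U : set X) (V : set Y) g h : zopen U -> zopen V ->
  tensor U V g -> tensor U V h -> tensor U V (fun p => g p * h p).
Proof.
move=> oU oV [m [a [b [ra rb gE]]]] [m' [a' [b' [ra' rb' hE]]]].
apply: (@tensor_fin ('I_m * 'I_m')%type U V
  (fun i x => a i.1 x * a' i.2 x) (fun i x => b i.1 x * b' i.2 x)).
- by move=> i; apply: nice_mul.
- by move=> i; apply: nice_mul.
- move=> p; rewrite gE hE big_distrlr /= pair_big /=.
  by apply: eq_bigr => i _; rewrite mulrACA.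
Qed.

Lemma tensor_prod (U : set X) (V : set Y) f g : zopen U -> zopen V ->
  regular U f -> regular V g -> tensor U V (fun p => f p.1 * g p.2).
Proof.
move=> oU oV rf rg; apply: (@tensor_fin unit U V (fun=> f) (fun=> g)) => // p.
by rewrite big_const card_unit /= addr0.
Qed.

Lemma tensor_cst (U : set X) (V : set Y) c : zopen U -> zopen V ->
  tensor U V (fun=> c).
Proof.
move=> oU oV; have -> : (fun=> c) = (fun p : X * Y => c * 1).
  by apply/funext => p; rewrite mulr1.
by apply: (@tensor_prod _ _ (fun=> c) (fun=> 1)) => //; apply: nice_cst.
Qed.

Lemma tensor_neq0_open (U : set X) (V : set Y) h : zopen U -> zopen V ->
  tensor U V h -> zopen ([set p | [/\ U p.1, V p.2 &
    h p != 0]] : set (product X Y)).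
Proof. by move=> oU oV th p [Up Vp hp]; exists U, V, h; split=> // q. Qed.

Lemma openI_product (W W' : set (product X Y)) :
  zopen W -> zopen W' -> zopen (W `&` W').
Proof.
move=> oW oW' p [Wp W'p].
have [U [V [h [[oU oV] [Up Vp] th hp hW]]]] := oW _ Wp.
have [U' [V' [h' [[oU' oV'] [U'p V'p] th' h'p hW']]]] := oW' _ W'p.
have oUU := nice_openI nX oU oU'; have oVV := nice_openI nY oV oV'.
exists (U `&` U'), (V `&` V'), (fun q => h q * h' q); split=> //.
- by apply: tensor_mul => //; [move: th|move: th'];
    apply: tensorS => //; by [apply: subIsetl|apply: subIsetr].
- by rewrite mulf_neq0.
- move=> q [Uq U'q] [Vq V'q]; rewrite mulf_eq0 negb_or => /andP[hq h'q].
  by split; [apply: hW|apply: hW'].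
Qed.

Lemma open_local_product (W : set (product X Y)) :
  locally W (fun U => U `<=` W) -> zopen W.
Proof.
move=> locW p /locW[W' [oW' W'p W'W]].
have [U [V [h [oUV UVp th hp hW]]]] := oW' _ W'p.
by exists U, V, h; split=> // q Uq Vq hq; apply/W'W/hW.
Qed.

(** The sum and the product of [a / b] and [c / d] can both be put over [b * d] and differ only in
    the numerator [num], so one argument serves both. *)
Lemma regular_binop_product (op : K -> K -> K)
    (num : K -> K -> K -> K -> K) (W : set (product X Y)) f f' :
  (forall a b c d, b != 0 -> d != 0 ->
     op (a / b) (c / d) = num a b c d / (b * d)) ->
  (forall (U : set X) (V : set Y) a b c d, zopen U -> zopen V ->
     tensor U V a -> tensor U V b -> tensor U V c -> tensor U V d ->
     tensor U V (fun p => num (a p) (b p) (c p) (d p))) ->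
  regular W f -> regular W f' -> regular W (fun p => op (f p) (f' p)).
Proof.
move=> opE tnum rf rf' p Wp.
have [U [V [g [h [[oU oV] [Up Vp] [tg th] hp hW]]]]] := rf _ Wp.
have [U' [V' [g' [h' [[oU' oV'] [U'p V'p] [tg' th'] h'p hW']]]]] := rf' _ Wp.
have oUU := nice_openI nX oU oU'; have oVV := nice_openI nY oV oV'.
have tl k : tensor U V k -> tensor (U `&` U') (V `&` V') k.
  by apply: tensorS => //; apply: subIsetl.
have tr k : tensor U' V' k -> tensor (U `&` U') (V `&` V') k.
  by apply: tensorS => //; apply: subIsetr.
exists (U `&` U'), (V `&` V'),
  (fun q => num (g q) (h q) (g' q) (h' q)), (fun q => h q * h' q).
split=> //.
- split; first by apply: tnum => //; by [apply: tl|apply: tr].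
  by apply: tensor_mul => //; by [apply: tl|apply: tr].
- by rewrite mulf_neq0.
- move=> q Wq [Uq U'q] [Vq V'q]; rewrite mulf_eq0 negb_or => /andP[hq h'q].
  by rewrite hW // hW' // opE.
Qed.

Lemma nice_product : nice (product X Y).
Proof.
have oX := nice_openT nX; have oY := nice_openT nY.
split.
- move=> p _; exists setT, setT, (fun=> 1); split=> //; first exact: tensor_cst.
  exact: oner_neq0.
- exact: openI_product.
- exact: open_local_product.
- move=> W f _ locW p Wp; have [W' [oW' W'p [g rg fg]]] := locW _ Wp.
  have [U [V [h [[oU oV] [Up Vp] th hp hW]]]] := oW' _ W'p.
  have [U' [V' [a [b [[oU' oV'] [U'p V'p] [ta tb] bp gab]]]]] := rg _ W'p.
  have oUU := nice_openI nX oU oU'; have oVV := nice_openI nY oV oV'.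
  have th' : tensor (U `&` U') (V `&` V') h.
    by apply: tensorS th => //; apply: subIsetl.
  have ta' : tensor (U `&` U') (V `&` V') a.
    by apply: tensorS ta => //; apply: subIsetr.
  have tb' : tensor (U `&` U') (V `&` V') b.
    by apply: tensorS tb => //; apply: subIsetr.
  exists (U `&` U'), (V `&` V'), (fun q => a q * h q), (fun q => b q * h q).
  split=> //; first by split; apply: tensor_mul.
    by rewrite mulf_neq0.
  move=> q Wq [Uq U'q] [Vq V'q]; rewrite mulf_eq0 negb_or => /andP[bq hq].
  have W'q := hW _ Uq Vq hq.
  by rewrite (fg _ Wq W'q) gab // -mulf_div divff // mulr1.
- move=> W c _ p _; exists setT, setT, (fun=> c), (fun=> 1); split=> //.
  + by split; apply: tensor_cst.
  + exact: oner_neq0.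
  + by move=> *; rewrite divr1.
- move=> W f g _; apply: (@regular_binop_product +%R
    (fun a b c d => a * d + c * b)); first by move=> *; apply: addf_div.
  by move=> U V a b c d oU oV ta tb tc td; apply: tensor_add; apply: tensor_mul.
- move=> W f g _; apply: (@regular_binop_product *%R (fun a b c d => a * c)).
    by move=> *; apply: mulf_div.
  by move=> U V a b c d oU oV ta tb tc td; apply: tensor_mul.
- move=> W f oW rf; apply: open_local_product => p [Wp /= fp].
  have [U [V [g [h [[oU oV] [Up Vp] [tg th] hp hW]]]]] := rf _ Wp.
  exists (W `&` [set p | [/\ U p.1, V p.2 & g p * h p != 0]]).
  split.
  + apply: openI_product => //; apply: (@tensor_neq0_open U V) => //.
    exact: tensor_mul.
  + split=> //; split=> //; rewrite mulf_neq0 //.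
    by apply: contraNneq fp => g0; rewrite hW // g0 mul0r.
  + move=> q [Wq [Uq Vq]]; rewrite mulf_eq0 negb_or => /andP[g0 h0].
    by split=> //=; rewrite hW // mulf_neq0 // invr_eq0.
- move=> W f oW rf f0 p Wp.
  have [U [V [g [h [[oU oV] [Up Vp] [tg th] hp hW]]]]] := rf _ Wp.
  exists U, V, (fun q => h q * h q), (fun q => g q * h q); split=> //.
  + by split; apply: tensor_mul.
  + rewrite mulf_neq0 //; apply: contraNneq (f0 _ Wp) => g0.
    by rewrite hW // g0 mul0r.
  + move=> q Wq Uq Vq; rewrite mulf_eq0 negb_or => /andP[g0 h0].
    by rewrite hW // invf_div -mulf_div divff // mulr1.
Qed.

End Product.

(** * Morphisms defined on an open subset *)

(** The function stays total and only its restriction to [U] is constrained, which accommodates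
    local inverses with arbitrary values elsewhere. *)
Definition morphism_on X Y (U : set X) (f : X -> Y) : Prop :=
  zopen U /\
  forall V, zopen V ->
    zopen (U `&` f @^-1` V) /\
    forall g, regular V g -> regular (U `&` f @^-1` V) (g \o f).

Lemma morphism_onT X Y (f : X -> Y) : nice X ->
  morphism f <-> morphism_on setT f.
Proof.
move=> nX; split=> [[oF rF]|[_ mF]].
  split=> [|V oV]; first exact: nice_openT.
  by rewrite setTI; split=> [|g rg]; [apply: oF|apply: rF].
by split=> V => [|g] oV; move: (mF _ oV); rewrite setTI => -[oF rF //] /rF.
Qed.

Lemma morphism_local X Y (f : X -> Y) : nice X ->
  (forall x, exists2 U : set X, U x & morphism_on U f) -> morphism f.
Proof.
move=> nX locf.
have oF V : zopen V -> zopen (f @^-1` V).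
  move=> oV; apply: (nice_open_local nX) => x Vx;
    have [U Ux [oU /(_ _ oV)[oUV _]]] := locf x.
  by exists (U `&` f @^-1` V); split=> // y [].
split=> // V g oV rg; apply: (nice_regular_local nX (oF _ oV)) => x Vx.
have [U Ux [oU /(_ _ oV)[oUV rUV]]] := locf x.
by exists (U `&` f @^-1` V); split=> //; exists (g \o f) => //; apply: rUV.
Qed.

Lemma morphism_onS X Y (U U' : set X) (f : X -> Y) : nice X ->
  zopen U' -> U' `<=` U -> morphism_on U f -> morphism_on U' f.
Proof.
move=> nX oU' sU [oU mf]; split=> // V oV; have [oUV rUV] := mf _ oV.
have e : U' `&` f @^-1` V = U' `&` (U `&` f @^-1` V).
  by rewrite setIA (setIidl sU).
have oUV' : zopen (U' `&` f @^-1` V) by rewrite e; apply: nice_openI.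
split=> // g rg; apply: nice_regularS (rUV _ rg) => // x [U'x Vx].
by split=> //; apply: sU.
Qed.

Lemma morphism_on_eq X Y (U : set X) (f g : X -> Y) : nice X ->
  (forall x, U x -> f x = g x) -> morphism_on U f -> morphism_on U g.
Proof.
move=> nX efg [oU mf]; split=> // V oV; have [oUV rUV] := mf _ oV.
have e : U `&` g @^-1` V = U `&` f @^-1` V.
  by rewrite predeqE => x; split=> -[Ux Vx]; split=> //; move: Vx;
    rewrite /preimage /= efg.
rewrite e; split=> // h rh; apply: nice_regular_eq (rUV _ rh) => // x [Ux _].
by rewrite /= efg.
Qed.

Lemma morphism_on_comp X Y Z (U : set X) (W : set Y) (f : X -> Y) (g : Y -> Z) :
  U `<=` f @^-1` W -> morphism_on U f -> morphism_on W g ->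
  morphism_on U (g \o f).
Proof.
move=> sU [oU mf] [oW mg]; split=> // V oV; have [oWV rWV] := mg _ oV.
have [oUV rUV] := mf _ oWV.
have e : U `&` (g \o f) @^-1` V = U `&` f @^-1` (W `&` g @^-1` V).
  by rewrite predeqE => x; split=> [[Ux Vx]|[Ux [_ Vx]]]; split=> //;
    split=> //; apply: sU.
by rewrite e; split=> // h /rWV/rUV.
Qed.

Lemma morphism_on_morphism X Y Z (U : set X) (f : X -> Y) (g : Y -> Z) :
  nice Y -> morphism_on U f -> morphism g -> morphism_on U (g \o f).
Proof.
by move=> nY mf /(morphism_onT _ nY)mg; apply: morphism_on_comp mf mg.
Qed.

Lemma morphism_on_regular X Y (U : set X) (f : X -> Y) (W : set Y) g :
  nice X -> zopen W -> regular W g -> U `<=` f @^-1` W ->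
  morphism_on U f -> regular U (g \o f).
Proof.
move=> nX oW rg sU [oU mf]; have [_ rW] := mf _ oW.
by move: (rW _ rg); rewrite (setIidl sU).
Qed.

Lemma morphism_cls X (e : X -> X -> Prop) : morphism (cls e : X -> quotient e).
Proof. by split. Qed.

Lemma morphism_existT (I : Type) (X : I -> Defs.space K) i :
  morphism (existT X i : X i -> coprod X).
Proof. by split=> V => [|g] oV; last move/(_ i); last apply. Qed.

Lemma morphism_sval X (A : set X) : nice X ->
  morphism (sval : subspace A -> X).
Proof.
move=> nX; split=> V => [|g] oV; first by exists V.
by move=> rg a Va; exists V, g.
Qed.

Lemma morphism_fst X Y : nice X -> nice Y -> morphism (fst : product X Y -> X).
Proof.
move=> nX nY; have oT := nice_openT nY; split=> V => [|g] oV.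
  move=> p Vp; exists V, setT, (fun=> 1); split=> //; first exact: tensor_cst.
  exact: oner_neq0.
move=> rg p Vp; exists V, setT, (g \o fst), (fun=> 1); split=> //.
- split; last exact: tensor_cst.
  have -> : g \o fst = (fun p : X * Y => g p.1 * 1).
    by apply/funext => q; rewrite mulr1.
  by apply: (@tensor_prod _ _ _ _ g (fun=> 1)) => //; apply: nice_cst.
- exact: oner_neq0.
- by move=> *; rewrite divr1.
Qed.

Lemma morphism_snd X Y : nice X -> nice Y -> morphism (snd : product X Y -> Y).
Proof.
move=> nX nY; have oT := nice_openT nX; split=> V => [|g] oV.
  move=> p Vp; exists setT, V, (fun=> 1); split=> //; first exact: tensor_cst.
  exact: oner_neq0.
move=> rg p Vp; exists setT, V, (g \o snd), (fun=> 1); split=> //.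
- split; last exact: tensor_cst.
  have -> : g \o snd = (fun p : X * Y => 1 * g p.2).
    by apply/funext => q; rewrite mul1r.
  by apply: (@tensor_prod _ _ _ _ (fun=> 1) g) => //; apply: nice_cst.
- exact: oner_neq0.
- by move=> *; rewrite divr1.
Qed.

Lemma morphism_on_subspace X Y (A : set Y) (U : set X) (f : X -> subspace A) :
  nice X -> nice Y -> morphism_on U (sval \o f : X -> Y) -> morphism_on U f.
Proof.
move=> nX nY [oU mf].
have oF (V : set (subspace A)) : zopen V -> zopen (U `&` f @^-1` V).
  by case=> V' oV' ->; have [] := mf _ oV'.
split=> // V oV; split=> [|g rg]; first exact: oF.
apply: (nice_regular_local nX (oF _ oV)) => x [Ux Vx].
have [W [h [oW Wx rh gh]]] := rg _ Vx; have [oUW rUW] := mf _ oW.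
exists (U `&` (sval \o f) @^-1` W); split=> //.
exists (h \o (sval \o f)); first exact: rUW.
by move=> y [Uy Vy] [_ Wy]; apply: gh.
Qed.

(** A polynomial in regular functions is regular, so its nonvanishing locus is open and quotients by
    it are regular there. *)
Lemma morphism_on_affine X m (U : set X) (f : X -> affine_space K m) :
  nice X -> zopen U -> (forall i, regular U (fun x => (f x : 'rV_m) 0 i)) ->
  morphism_on U f.
Proof.
move=> nX oU rf.
have rp (p : {mpoly K[m]}) : regular U (fun x => peval p (f x)).
  rewrite /peval; under eq_fun do rewrite mevalE.
  apply: (@nice_sum _ U _ (msupp p) (fun mo x =>
    p@_mo * \prod_i (f x : 'rV_m) 0 i ^+ mo i)) => // mo.
  apply: nice_mul => //; first exact: nice_cst.
  by apply: nice_prod => // i; apply: nice_exp.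
have oF V : zopen V -> zopen (U `&` f @^-1` V).
  move/zopen_affineP => oV; apply: (nice_open_local nX) => x [Ux Vx].
  have [h hx hV] := oV _ Vx.
  exists (U `&` [set x | peval h (f x) != 0]); split=> //;
    first exact: nice_openD.
  by move=> y [Uy /hV].
split=> // V oV; split=> [|g rg]; first exact: oF.
apply: (nice_regular_local nX (oF _ oV)) => x [Ux Vx].
have [a [b [b0 gab]]] := rg _ Vx.
have oW := nice_openD nX oU (rp b).
exists (U `&` [set x | peval b (f x) != 0]); split=> //.
exists (fun x => peval a (f x) / peval b (f x)).
  by apply: nice_div => //; try (by move=> y []);
     apply: nice_regularS (rp _) => // y [].
by move=> y [Uy Vy] [_ /= bn0]; apply: gab.
Qed.

(** Along the pair of maps an element of the tensor product pulls back to a finite sum of products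
    of regular functions ([rt]); open sets and regular functions of the product are locally built
    from such elements. *)
Lemma morphism_on_product X Y Z (U : set X) (f : X -> Y) (g : X -> Z) :
  nice X -> morphism_on U f -> morphism_on U g ->
  morphism_on U (fun x => (f x, g x) : product Y Z).
Proof.
move=> nX [oU mf] [_ mg].
pose F x : product Y Z := (f x, g x); rewrite -/F.
have rt A B (h : Y * Z -> K) : zopen A -> zopen B -> tensor A B h ->
    let U' := U `&` f @^-1` A `&` (U `&` g @^-1` B) in
    zopen U' /\ regular U' (h \o F).
  move=> oA oB [m [a [b [ra rb hE]]]] U'.
  have [oUA rUA] := mf _ oA; have [oUB rUB] := mg _ oB.
  have oU' : zopen U' by apply: nice_openI.
  split=> //; have -> : h \o F = fun x => \sum_i a i (f x) * b i (g x).
    by apply/funext => x /=; rewrite hE.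
  apply: nice_sum => // i; apply: nice_mul => //.
    by apply: nice_regularS (rUA _ (ra i)) => //; apply: subIsetl.
  by apply: nice_regularS (rUB _ (rb i)) => //; apply: subIsetr.
have oF V : zopen V -> zopen (U `&` F @^-1` V).
  move=> oV; apply: (nice_open_local nX) => x [Ux Vx].
  have [A [B [h [[oA oB] [Ax Bx] th hx hV]]]] := oV _ Vx.
  have [oU' rh] := rt _ _ _ oA oB th.
  exists (U `&` f @^-1` A `&` (U `&` g @^-1` B) `&` [set x | h (F x) != 0]).
  split=> //; first exact: (nice_openD nX oU' rh).
  by move=> y [[[Uy Ay] [_ By]] hy]; split=> //; apply: hV.
split=> // V oV; split=> [|k rk]; first exact: oF.
apply: (nice_regular_local nX (oF _ oV)) => x [Ux Vx].
have [A [B [a [b [[oA oB] [Ax Bx] [ta tb] bx kab]]]]] := rk _ Vx.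
have [oU' ra] := rt _ _ _ oA oB ta; have [_ rb] := rt _ _ _ oA oB tb.
have oW := nice_openD nX oU' rb.
exists (U `&` f @^-1` A `&` (U `&` g @^-1` B) `&` [set x | (b \o F) x != 0]).
split=> //; exists (fun x => (a \o F) x / (b \o F) x).
  by apply: nice_div => //; try (by move=> y []);
     [move: ra|move: rb]; apply: nice_regularS => // y [].
by move=> y [Uy Vy] [[[_ Ay] [_ By]] hb]; apply: kab.
Qed.

(** Both parts of the structure of a quotient are defined by pulling back along [cls], so the two
    statements are convertible. *)
Lemma morphism_on_quotient X Y (e : X -> X -> Prop) (U : set (quotient e))
    (f : quotient e -> Y) :
  morphism_on (cls e @^-1` U) (f \o cls e) -> morphism_on U f.
Proof. by []. Qed.

Lemma morphism_coprod (I : Type) (X : I -> Defs.space K) Y (f : coprod X -> Y) :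
  (forall i, morphism (f \o existT X i : X i -> Y)) -> morphism f.
Proof.
move=> mf; split=> V => [|g] oV; first by move=> i; apply: (mf i).1.
by move=> rg i; apply: (mf i).2.
Qed.

(** Used for the inverse of the embedding, which is known only locally as the restriction of a map
    from an open part of the ambient projective space. *)
Lemma morphism_subspace_local X Y (A : set X) (g : subspace A -> Y) : nice X ->
  (forall a : subspace A, exists (U : set X) (G : X -> Y),
     [/\ U (sval a), morphism_on U G & forall b, U (sval b) ->
       g b = G (sval b)]) ->
  morphism g.
Proof.
move=> nX locg; apply: morphism_local => [|a]; first exact: nice_subspace.
have [U [G [Ua mG gG]]] := locg a; exists (sval @^-1` U) => //.
have nA := nice_subspace A nX; have [oU _] := mG.
apply: (@morphism_on_eq (subspace A) Y _ (G \o sval)) => //.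
  by move=> b /gG.
apply: (@morphism_on_comp (subspace A) X Y _ U sval G) mG => //;
  apply: morphism_onS (_ : morphism_on setT _) => //.
  by exists U.
by apply/morphism_onT => //; apply: morphism_sval.
Qed.

End SpacesWithFunctions.

(** * Hilbert functions of varieties parametrized by monomials *)

Section HilbertFunctions.
Variable K : closedFieldType.

(** [muni] turns the last variable into the univariate one; this recovers [p] from [muni p] in the
    induction on the number of variables. *)
Lemma mcoeff_muni n (p : {mpoly K[n.+1]}) (m : 'X_{1..n}) j :
  (muni p)`_j@_m = p@_[multinom of rcons m j].
Proof.
have mE (m' : 'X_{1..n.+1}) :
    (m' == [multinom of rcons m j]) =
    (([multinom m' (widen_ord (leqnSn n) i) | i < n] == m) && (m' ord_max ==
      j)).
  have wE i : [multinom of rcons m j] (widen_ord (leqnSn n) i) = m i.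
    rewrite [LHS]multinomE (tnth_nth 0%N) /= nth_rcons size_tuple ltn_ord.
    by rewrite (mnm_nth 0%N).
  have mx : [multinom of rcons m j] ord_max = j.
    by rewrite multinomE (tnth_nth 0%N) /= nth_rcons size_tuple ltnn eqxx.
  apply/eqP/andP => [->|[/eqP/mnmP e1 /eqP e2]].
    by split; apply/eqP; rewrite ?mx //; apply/mnmP => i; rewrite mnmE wE.
  apply/mnmP => i; case: (unliftP ord_max i) => [i' ->|->]; last by rewrite mx.
  have -> : lift ord_max i' = widen_ord (leqnSn n) i'.
    by apply: val_inj; rewrite /= /bump leqNgt ltn_ord.
  by have := e1 i'; rewrite mnmE wE.
rewrite muniE coef_sum raddf_sum /= [in RHS](mpolyE p) raddf_sum /=.
apply: eq_bigr => m' _; rewrite mcoeffZ mcoeffX mE coefZ coefXn eq_sym.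
case: eqP => _; last by rewrite mulr0 mcoeff0 andbF mulr0.
by rewrite mulr1 mcoeffZ mcoeffX andbT.
Qed.

(** Induction on the number of variables. With all variables but the last fixed, the polynomial has
    every element of [K] as a root, hence is zero because a nonzero univariate polynomial over a
    closed field has a non-root; its coefficients then vanish identically. *)
Lemma mpoly_vanish n (p : {mpoly K[n]}) : (forall u, p.@[u] = 0) -> p = 0.
Proof.
elim: n p => [|n IH] p p0.
  have m0 (m : 'X_{1..0}) : m = 0%MM by apply/mnmP => -[].
  have pE : p = (p@_0%MM)%:MP.
    by apply/mpolyP => m; rewrite mcoeffC (m0 m) eqxx mulr1.
  by rewrite pE; move: (p0 (fun=> 0)); rewrite {1}pE mevalC => ->.
pose ext (u : 'I_n -> K) x (i : 'I_n.+1) := oapp u x (unlift ord_max i).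
have evE u x : p.@[ext u x] = (map_poly (meval u) (muni p)).[x].
  rewrite muniE [in LHS](mpolyE p) !rmorph_sum horner_sum /=.
  apply: eq_bigr => m _; rewrite -mul_polyC rmorphM /= map_polyXn map_polyC /=.
  rewrite hornerCM hornerXn mevalZ mevalZ -mulrA; congr (_ * _).
  rewrite !mevalX big_ord_recr /= /ext unlift_none /=; congr (_ * _).
  apply: eq_bigr => i _.
  have -> : widen_ord (leqnSn n) i = lift ord_max i.
    by apply: val_inj; rewrite /= /bump leqNgt ltn_ord.
  by rewrite liftK mnmE; congr (_ ^+ m _); apply: val_inj;
    rewrite /= /bump leqNgt ltn_ord.
have q0 : muni p = 0.
  apply/polyP => j; rewrite coef0; apply: IH => u.
  have : map_poly (meval u) (muni p) == 0.
    apply/negPn/negP => /closed_nonrootP[x /negP]; apply.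
    by rewrite /root -evE p0.
  by move=> /eqP/polyP/(_ j); rewrite coef_map coef0.
apply/mpolyP => m; rewrite mcoeff0.
have [m' m'E] : exists m' : 'X_{1..n}, forall i,
  m' i = m (widen_ord (leqnSn n) i).
  by exists [multinom m (widen_ord (leqnSn n) i) | i < n] => i; rewrite mnmE.
have -> : m = [multinom of rcons m' (m ord_max)].
  apply/mnmP => i; rewrite [RHS]multinomE (tnth_nth 0%N) /= nth_rcons
    size_tuple.
  case: ltnP => [lt_i|ge_i].
    have -> : i = widen_ord (leqnSn n) (Ordinal lt_i) by apply: val_inj.
    by rewrite -(mnm_nth 0%N m' (Ordinal lt_i)) m'E.
  have -> : i = ord_max.
    by apply: val_inj => /=; apply/eqP; rewrite eqn_leq ge_i andbT -ltnS.
  by rewrite eqxx.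
by rewrite -mcoeff_muni q0 coef0 mcoeff0.
Qed.

(* The image of F is the cone over Z, up to the origin, and I indexes the     *)
(* monomials in u that occur in the degree m monomials in the F u i.          *)
Lemma hilbert_function_monomial (N m r : nat) (Z : set (proj_space K N))
    (c : 'I_N.+1 -> K) (M : 'I_N.+1 -> 'X_{1..r}) (I : finType)
    (s : I -> 'X_{1..r}) :
  let F u i := c i * \prod_(a < r) u a ^+ M i a in
  let w (mo : 'X_{1..N.+1}) := (\sum_i M i *+ mo i)%MM in
  (forall p : dhomog N.+1 K m,
     (forall v : punctured K N, Z (cls (@proportional K N) v) ->
        peval p (vec v) = 0) <-> (forall u, p.@[F u] = 0)) ->
  injective s ->
  (forall mo : 'X_{1..N.+1}, mdeg mo = m -> exists i, w mo = s i) ->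
  (forall i, exists mo : 'X_{1..N.+1},
     [/\ mdeg mo = m, \prod_j c j ^+ mo j != 0 & w mo = s i]) ->
  hilbert_function Z m #|I|.
Proof.
move=> F w ZP s_inj w_s s_w.
(* [p \mPo T] is the pullback of [p] along the parametrization; it multiplies exponents through [w]
   and monomials only acquire constants. *)
pose T := [tuple c i *: 'X_[M i] : {mpoly K[r]} | i < N.+1].
have TF p u : (p \mPo T).@[u] = p.@[F u].
  rewrite comp_mpoly_meval; apply: meval_eq => i.
  by rewrite tnth_mktuple mevalZ mevalX.
have TX mo : 'X_[mo] \mPo T = (\prod_j c j ^+ mo j) *: 'X_[w mo].
  rewrite comp_mpolyX /w.
  transitivity (\prod_i ((c i ^+ mo i) *: 'X_[M i *+ mo i] : {mpoly K[r]})).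
    by apply: eq_bigr => i _; rewrite tnth_mktuple exprZn mpolyXn.
  by rewrite scaler_prod mprodXE.
(* [L] reads off the coefficients of the pullback at the monomials [s i]. Its kernel is the degree
   [m] part of the ideal and it is onto, so rank-nullity gives the dimension. *)
pose L (p : dhomog N.+1 K m) : 'rV[K]_#|I| :=
  \row_i (mpoly_of_dhomog p \mPo T)@_(s (enum_val i)).
have L_lin : linear L.
  move=> a p q; apply/rowP => i; rewrite !mxE /=.
  by rewrite comp_mpolyD comp_mpolyZ mcoeffD mcoeffZ.
pose Lm := GRing.isLinear.Build _ _ _ _ L L_lin.
pose f := linfun (HB.pack L Lm : {linear _ -> _}).
have fE p : f p = L p by rewrite lfunE.
have kerE (p : dhomog N.+1 K m) : f p = 0 -> mpoly_of_dhomog p \mPo T = 0.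
  rewrite fE => Lp0; apply/mpolyP => mo; rewrite mcoeff0.
  have [[i wi]|ns] := pselect (exists i, mo = s i).
    by move/rowP: Lp0 => /(_ (enum_rank i)); rewrite !mxE enum_rankK -wi.
  (* No monomial of degree [m] is carried to an exponent outside the image of [s], so this
     coefficient vanishes for every [p]. *)
  rewrite comp_mpolyEX raddf_sum /= big_seq big1 // => mo' hmo'.
  rewrite TX !mcoeffZ mcoeffX; case: eqP => [e|]; last by rewrite !mulr0.
  case: ns; rewrite -e; apply: w_s.
  by have /dhomogP := dhomog_is_dhomog p; apply.
exists (lker f); split.
  move=> p; rewrite memv_ker; split=> [/eqP/kerE p0|/ZP p0].
    by apply/ZP => u; rewrite -TF p0 meval0.
  have T0 : mpoly_of_dhomog p \mPo T = 0 by apply: mpoly_vanish => u;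
    rewrite TF.
  by apply/eqP; rewrite fE; apply/rowP => i; rewrite !mxE T0 mcoeff0.
rewrite -(limg_ker_dim f fullv) capfv addKn.
suff -> : limg f = fullv by rewrite dimvf dim_matrix mul1r.
apply/vspaceP => v; rewrite memvf; rewrite [v]matrix_sum_delta big_ord1.
apply: rpred_sum => j _; apply: rpredZ.
(* A monomial carried to a nonzero multiple of the j-th target monomial hits the j-th basis vector
   after rescaling. *)
have [mo [dmo cmo wmo]] := s_w (enum_val j).
have hX : ('X_[mo] : {mpoly K[N.+1]}) \is m.-homog by rewrite dhomogX /= dmo.
pose p := DHomog hX.
have -> : delta_mx 0 j = (\prod_j c j ^+ mo j)^-1 *: f p.
  rewrite fE; apply/rowP => i; rewrite !mxE /= TX mcoeffZ mcoeffX wmo mulrA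
    mulVf //.
  by rewrite mul1r (inj_eq s_inj) (inj_eq enum_val_inj) eq_sym.
by apply: rpredZ; apply: memv_img; apply: memvf.
Qed.

End HilbertFunctions.

(** * Projective space and projectivized bundles as quotients *)

Section Projective.
Variable K : closedFieldType.

Lemma cls_eqP (T : Type) (e : T -> T -> Prop) :
  (forall x, e x x) -> (forall x y, e x y -> e y x) ->
  (forall x y z, e x y -> e y z -> e x z) ->
  forall x y, cls e x = cls e y <-> e x y.
Proof.
move=> er es et x y; split=> [/(congr1 sval)/= exy|exy].
  by have : [set z | e y z] y by []; rewrite -exy.
apply: eq_sig_hprop => [B p1 p2|/=]; first exact: Prop_irrelevance.
by rewrite predeqE => z; split; apply: et => //; apply: es.
Qed.

Lemma proj_eqP N (v w : punctured K N) :
  cls (@proportional K N) v = cls (@proportional K N) w <-> proportional v w.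
Proof.
apply: cls_eqP => [x|x y [c c0 E]|x y z [c c0 E] [d d0 F]].
- by exists 1; rewrite ?oner_neq0 ?scale1r.
- by exists c^-1; rewrite ?invr_eq0 // E scalerA mulVf // scale1r.
- by exists (d * c); rewrite ?mulf_neq0 // F E scalerA.
Qed.

Lemma vec_neq0 N (v : punctured K N) : vec v != 0.
Proof. by apply/eqP; apply: (svalP v). Qed.

Section Bundle.
Variables (X : Defs.space K) (r : nat) (E : bundle X r).
Implicit Types p q : nonzero_charts E.

Lemma dom_base p : dom (projT1 p) (base p).
Proof. by case: p => i [[x u] [/= dx u0]]. Qed.

Lemma coords_neq0 p : coords p != 0.
Proof. by case: p => i [[x u] [/= dx u0]]; apply/eqP. Qed.

(** The cocycle condition makes [same_line] symmetric and transitive, and [trans_id] makes it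
    reflexive. *)
Lemma same_line_eqP p q :
  cls (@same_line _ _ _ E) p = cls (@same_line _ _ _ E) q <-> same_line p q.
Proof.
apply: cls_eqP => [x|x y [bxy [c c0 exy]]|x y z [bxy [c c0 exy]] [byz [d d0
  eyz]]].
- split=> //; exists 1; rewrite ?oner_neq0 // scale1r trans_id ?mulmx1 //.
  exact: dom_base.
- split; first by rewrite bxy.
  have dx := dom_base x; have dy := dom_base y.
  exists c^-1; rewrite ?invr_eq0 // exy -bxy -scalemxAl scalerA mulVf //
    scale1r.
  rewrite -mulmxA trans_cocycle ?trans_id ?mulmx1 //; by rewrite bxy.
- split; first by rewrite bxy.
  exists (d * c); rewrite ?mulf_neq0 // eyz exy -bxy -scalemxAl scalerA.
  rewrite -mulmxA trans_cocycle //; first exact: dom_base.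
    by rewrite bxy; apply: dom_base.
  by rewrite bxy byz; apply: dom_base.
Qed.

Lemma bundle_proj_cls p : bundle_proj (cls (@same_line _ _ _ E) p) = base p.
Proof.
rewrite /bundle_proj.
by have /same_line_eqP[] := cls_repr (cls (@same_line _ _ _ E) p).
Qed.

End Bundle.

(* The junk value outside A is a0. *)
Definition to_sub (X : Defs.space K) (A : set X) (a0 : subspace A) (x : X) :
    subspace A :=
  if pselect (A x) is left Ax then exist _ x Ax else a0.

Lemma sval_to_sub (X : Defs.space K) (A : set X) (a0 : subspace A) (x : X) :
  A x -> sval (to_sub a0 x) = x.
Proof. by rewrite /to_sub; case: pselect. Qed.

Lemma morphism_on_to_sub (X Y : Defs.space K) (A : set Y) (a0 : subspace A)
    (U : set X) (f : X -> Y) : nice X -> nice Y -> U `<=` f @^-1` A ->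
  morphism_on U f -> morphism_on U (to_sub a0 \o f).
Proof.
move=> nX nY UA mf; apply: morphism_on_subspace => //.
by apply: morphism_on_eq mf => // x /UA Ax; rewrite /= sval_to_sub.
Qed.

Lemma nice_punctured N : nice (punctured K N).
Proof. exact/nice_subspace/nice_affine. Qed.

Lemma nice_proj N : nice (proj_space K N).
Proof. exact/nice_quotient/nice_punctured. Qed.

Lemma nice_nonzero_charts (X : Defs.space K) r (E : bundle X r) : nice X ->
  nice (nonzero_charts E).
Proof.
move=> nX; apply: nice_coprod => i; apply: nice_subspace.
exact/nice_product/nice_affine.
Qed.

Lemma regular_vec N (i : 'I_N.+1) :
  regular (setT : set (punctured K N)) (fun v => vec v 0 i).
Proof.
by have [_ /(_ _ _ (nice_openT (nice_affine K _)) (regular_coord i))] :=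
  morphism_sval [set v : affine_space K N.+1 | v <> 0] (nice_affine K N.+1).
Qed.

Lemma zopen_vec_neq0 N (i : 'I_N.+1) :
  zopen [set v : punctured K N | vec v 0 i != 0].
Proof.
rewrite -[X in zopen X]setTI; apply: nice_openD (regular_vec i).
  exact: nice_punctured.
exact/nice_openT/nice_punctured.
Qed.

Lemma regular_hratio N (i j : 'I_N.+1) : regular (std_open j) (@hratio K N i j).
Proof.
have nP := nice_punctured N.
apply: (@nice_regular_eq _ (punctured K N) [set v | vec v 0 j != 0] _
  (fun v => vec v 0 i / vec v 0 j)) => //.
- exact: zopen_vec_neq0.
- exact: std_open_open.
- by move=> v /std_open_cls.
- by move=> v _; rewrite /= hratio_cls.
have oD := zopen_vec_neq0 j.
by apply: nice_div => //; apply: nice_regularS (regular_vec _) => //;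
  apply: nice_openT.
Qed.

Lemma peval_scale N m (p : dhomog N.+1 K m) a (v : 'rV_N.+1) :
  peval p (a *: v) = a ^+ m * peval p v.
Proof.
rewrite /peval !mevalE mulr_sumr big_seq [RHS]big_seq; apply: eq_bigr => mo hmo.
rewrite mulrCA; congr (_ * _).
under eq_bigr do rewrite mxE exprMn.
rewrite big_split prodrXr /=; congr (_ ^+ _ * _).
have /dhomogP/(_ _ hmo) <- := dhomog_is_dhomog p.
by rewrite /= mdegE.
Qed.

End Projective.

(** * The scroll *)

Lemma ord2P (P : 'I_2 -> Prop) : P 0 -> P 1 -> forall a, P a.
Proof.
move=> P0 P1 [[|[|//]] lt_a]; [move: P0|move: P1]; congr P; exact: val_inj.
Qed.

(** * The monomial parametrization of the cone and its determinantal equations *)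

Section Scroll.
Variables (K : closedFieldType) (n A B N : nat).
Hypotheses (A_gt0 : (0 < A)%N) (BE : B = (A + n)%N) (NE : N = (A + B).+1).
Implicit Types (w y : 'rV[K]_2) (v : 'rV[K]_N.+1).

Let B_gt0 : (0 < B)%N. Proof. by rewrite BE addn_gt0 A_gt0. Qed.

(* The coordinates of P^N are indexed by the pairs (e, l) with                *)
(* l <= block_deg e; the coordinate (e, l) is the product of a fibre          *)
(* coordinate, that of O if e is false and that of O(-n) otherwise, with      *)
(* x_0 ^ (block_deg e - l) x_1 ^ l.                                           *)
Definition block_deg (e : bool) : nat := if e then B else A.
Definition block (j : nat) : bool := (A < j)%N.
Definition offset (j : nat) : nat := if block j then (j - A.+1)%N else j.
Definition coord_ix (e : bool) (l : nat) : 'I_N.+1 :=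
  inord (if e then (A.+1 + l)%N else l).
Definition fibre_ix (e : bool) : 'I_2 := if e then 1 else 0.

Lemma block_deg_gt0 e : (0 < block_deg e)%N. Proof. by case: e. Qed.

Lemma coord_ix_val e l : (l <= block_deg e)%N ->
  coord_ix e l = (if e then (A.+1 + l)%N else l) :> nat.
Proof.
by move=> lD; rewrite inordK // NE; case: e lD => /= lD; lia.
Qed.

Lemma block_coord_ix e l : (l <= block_deg e)%N -> block (coord_ix e l) = e.
Proof. by move=> lD; rewrite /block coord_ix_val //; case: e lD => /= lD;
  lia. Qed.

Lemma offset_coord_ix e l : (l <= block_deg e)%N -> offset (coord_ix e l) = l.
Proof.
by move=> lD; rewrite /offset block_coord_ix // coord_ix_val //;
  case: e lD => /= lD; lia.
Qed.

Lemma offset_le (j : 'I_N.+1) : (offset j <= block_deg (block j))%N.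
Proof. by have := ltn_ord j; have := NE; rewrite /offset /block /block_deg;
  case: (ltnP A j); lia. Qed.

Lemma coord_ix_offset (j : 'I_N.+1) : coord_ix (block j) (offset j) = j.
Proof.
apply: val_inj; rewrite /= coord_ix_val ?offset_le // /offset /block.
by case: (ltnP A j) => //; lia.
Qed.

Lemma fibre_ixK (a : 'I_2) : fibre_ix (a == 1) = a.
Proof. by elim/ord2P: a. Qed.

Lemma fibre_ix_eq1 e : (fibre_ix e == 1) = e. Proof. by case: e. Qed.

Definition scroll_vec (w y : 'rV[K]_2) : 'rV[K]_N.+1 :=
  \row_j (y 0 (fibre_ix (block j)) * w 0 0 ^+ (block_deg (block j) - offset j) *
    w 0 1 ^+ offset j).

Lemma scroll_vec_coord_ix w y e l : (l <= block_deg e)%N ->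
  scroll_vec w y 0 (coord_ix e l) = y 0 (fibre_ix e) * w 0 0 ^+ (block_deg e -
    l) * w 0 1 ^+ l.
Proof. by move=> lD; rewrite mxE block_coord_ix // offset_coord_ix. Qed.

Lemma row_coord_ixP (v v' : 'rV[K]_N.+1) :
  (forall e l, (l <= block_deg e)%N ->
    v 0 (coord_ix e l) = v' 0 (coord_ix e l)) -> v = v'.
Proof. by move=> vv'; apply/rowP => j;
  rewrite -(coord_ix_offset j) vv' // offset_le. Qed.

(** The ordinal [j] acts as the number 0 or 1, so [j * block_deg e] is the end of the block that
    carries the pure power of [w 0 j]. *)
Lemma scroll_vec_corner w y e (j : 'I_2) :
  scroll_vec w y 0 (coord_ix e (j * block_deg e)) = y 0 (fibre_ix e) * w 0 j ^+
    block_deg e.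
Proof.
elim/ord2P: j.
  by rewrite mul0n scroll_vec_coord_ix // subn0 mulr1.
by rewrite mul1n scroll_vec_coord_ix // subnn mulr1.
Qed.

(** The two coordinates are the corner of the previous lemma and its neighbour: offsets 0, 1 for
    [j = 0] and D - 1, D for [j = 1], with D the block degree. As a pair they are a multiple of
    [w]. *)
Lemma scroll_vec_pair w y e (j a : 'I_2) :
  scroll_vec w y 0 (coord_ix e (j * (block_deg e).-1 + a)) =
  y 0 (fibre_ix e) * w 0 j ^+ (block_deg e).-1 * w 0 a.
Proof.
have D1 := block_deg_gt0 e.
have le : (j * (block_deg e).-1 + a <= block_deg e)%N by case: j a =>
  -[|[|//]] ? [[|[|//]] ?] /=; lia.
rewrite scroll_vec_coord_ix //; elim/ord2P: j le; elim/ord2P: a => le.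
- by rewrite mul0n addn0 subn0 mulr1 -mulrA -exprSr prednK.
- by rewrite mul0n add0n subn1.
- rewrite mul1n addn0 -(subn1 (block_deg e)) subKn // expr1.
  by rewrite mulrAC.
- by rewrite mul1n addn1 prednK // subnn mulr1 -mulrA -exprSr prednK.
Qed.

Lemma scroll_vec_scale c (w y y' : 'rV[K]_2) : c != 0 ->
  (forall e, y' 0 (fibre_ix e) = c ^+ block_deg e * y 0 (fibre_ix e)) ->
  scroll_vec (c *: w) y = scroll_vec w y'.
Proof.
move=> c0 yy'; apply: row_coord_ixP => e l lD;
  rewrite !scroll_vec_coord_ix // yy' !mxE !exprMn.
have -> : c ^+ block_deg e = c ^+ (block_deg e - l) * c ^+ l by rewrite -exprD
  subnK.
ring.
Qed.

Lemma scroll_vec_scaler c w y : scroll_vec w (c *: y) = c *: scroll_vec w y.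
Proof. by apply: row_coord_ixP => e l lD;
  rewrite [RHS]mxE !scroll_vec_coord_ix // mxE !mulrA. Qed.

Lemma scroll_vec_neq0 w y : w != 0 -> y != 0 -> scroll_vec w y != 0.
Proof.
move=> /rV0Pn[j wj] /rV0Pn[a ya]; apply/rV0Pn.
exists (coord_ix (a == 1) (j * block_deg (a == 1))).
by rewrite scroll_vec_corner fibre_ixK mulf_neq0 // expf_neq0.
Qed.

Lemma scroll_vec0l y : scroll_vec 0 y = 0.
Proof.
apply: row_coord_ixP => e l lD; rewrite scroll_vec_coord_ix // !mxE -mulrA
  -exprD subnK //.
by rewrite expr0n gtn_eqF ?block_deg_gt0 // mulr0.
Qed.

Lemma scroll_vec0r w : scroll_vec w 0 = 0.
Proof. by apply: row_coord_ixP => e l lD;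
  rewrite scroll_vec_coord_ix // !mxE !mul0r. Qed.

(* The equations are the 2 x 2 minors of the matrix with the columns          *)
(* (v_(e,l), v_(e,l+1)).                                                      *)
Lemma minors_scroll_vec (v : 'rV[K]_N.+1) : v != 0 ->
  (forall e l e' l', (l < block_deg e)%N -> (l' < block_deg e')%N ->
     v 0 (coord_ix e l) * v 0 (coord_ix e' l'.+1) = v 0 (coord_ix e l.+1) * v 0
       (coord_ix e' l')) ->
  exists w y, [/\ w != 0, y != 0 & v = scroll_vec w y].
Proof.
move=> v0 minors.
(* A nonzero coordinate lies in some column; at the end of a block it is the lower entry of the
   preceding column. *)
have [e0 [l0 [l0D pair0]]] : exists e0 l0, (l0 < block_deg e0)%N /\
    ((v 0 (coord_ix e0 l0) != 0) || (v 0 (coord_ix e0 l0.+1) != 0)).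
  have [j vj] := rV0Pn _ v0; have := offset_le j;
    rewrite -(coord_ix_offset j) in vj.
  rewrite leq_eqVlt => /orP[/eqP pj|pj]; last first.
    by exists (block j), (offset j); rewrite vj.
  exists (block j), (offset j).-1; have := block_deg_gt0 (block j);
    rewrite -pj => p0.
  by rewrite prednK // leqnn vj orbT.
pose s := v 0 (coord_ix e0 l0); pose t := v 0 (coord_ix e0 l0.+1).
have st e l : (l < block_deg e)%N ->
  s * v 0 (coord_ix e l.+1) = t * v 0 (coord_ix e l).
  exact: minors.
suff [w [y [w0 vE]]] : exists w y, w != 0 /\ v = scroll_vec w y.
  exists w, y; split=> //; apply: contraNneq v0 => y0.
  by rewrite vE y0 scroll_vec0r.
(* With the pivot column (0, t) the base point is (0 : 1): only the last coordinate of each block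
   survives, and these are [y]. *)
have [s0|s0] := eqVneq s 0.
  have t0 : t != 0 by move: pair0; rewrite -/s -/t s0 eqxx.
  exists (\row_(a < 2) (a == 1)%:R),
    (\row_(a < 2) v 0 (coord_ix (a == 1) (block_deg (a == 1)))).
  split; first by apply/rV0Pn; exists 1; rewrite mxE oner_neq0.
  apply: row_coord_ixP => e l lD; rewrite scroll_vec_coord_ix // !mxE
    fibre_ix_eq1 expr0n expr1n mulr1.
  move: lD; rewrite leq_eqVlt => /orP[/eqP->|lD].
    by rewrite subnn mulr1.
  rewrite subn_eq0 leqNgt lD mulr0; apply: (mulfI t0).
  by rewrite -st // s0 mul0r mulr0.
(* Otherwise the base point is (1 : t/s), each block is a geometric progression with ratio t/s, and
   its first term is the entry of [y]. *)
exists (\row_(a < 2) (if a == 1 then t / s else 1)),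
  (\row_(a < 2) v 0 (coord_ix (a == 1) 0)).
split; first by apply/rV0Pn; exists 0; rewrite mxE oner_neq0.
apply: row_coord_ixP => e l lD; rewrite scroll_vec_coord_ix // !mxE fibre_ix_eq1
  expr1n mulr1.
elim: l lD => [|l IH] lD; first by rewrite mulr1.
apply: (mulfI s0); rewrite st // IH; last exact: ltnW.
by rewrite exprS; field.
Qed.

Lemma scroll_vec_minors w y e l e' l' : (l < block_deg e)%N ->
  (l' < block_deg e')%N ->
  scroll_vec w y 0 (coord_ix e l) * scroll_vec w y 0 (coord_ix e' l'.+1) =
  scroll_vec w y 0 (coord_ix e l.+1) * scroll_vec w y 0 (coord_ix e' l').
Proof.
move=> lD l'D; rewrite !scroll_vec_coord_ix //; try exact: ltnW.
rewrite -(subnSK lD) -(subnSK l'D) !exprS; ring.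
Qed.

(** * The map from F_n to projective space and its image *)

Local Notation E := (hirzebruch_bundle K n).
Local Notation PN := (proj_space K N).
Local Notation P1 := (proj_space K 1).
Local Notation line := (cls (@same_line _ _ _ E)).
Local Notation pcls := (cls (@proportional K _)).
Implicit Types p q : nonzero_charts E.

Lemma hratioV (i j : 'I_2) (x : P1) : (hratio i j x)^-1 = hratio j i x.
Proof. by rewrite /hratio invf_div. Qed.

Lemma hratio_neq0 (i j : 'I_2) (x : P1) :
  std_open i x -> std_open j x -> hratio i j x != 0.
Proof. by move=> xi xj; rewrite mulf_neq0 // invr_eq0. Qed.

(** [block_deg e - A] is 0 on the summand O and n on O(-n), so it is the negative of the twist; this
    is why the ratio of coordinates appears inverted. *)
Lemma hirzebruch_same_lineP p q : same_line p q <-> base p = base q /\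
  exists2 c : K, c != 0 & forall e, coords q 0 (fibre_ix e) =
    c * (coords p 0 (fibre_ix e) *
         hratio (projT1 q) (projT1 p) (base p) ^+ (block_deg e - A)).
Proof.
have trE e : (coords p *m trans (projT1 p) (projT1 q) (base p)) 0 (fibre_ix e) =
    coords p 0 (fibre_ix e) * hratio (projT1 q) (projT1 p) (base p) ^+
      (block_deg e - A).
  rewrite /= /twist_trans mul_mx_diag !mxE; congr (_ * _).
  case: e => /=; last by rewrite subnn expr0z.
  by rewrite BE addKn -exprz_inv hratioV.
split=> -[bpq [c c0 cE]]; split=> //; exists c => //.
  by move=> e; rewrite cE [LHS]mxE trE.
apply/rowP => a; rewrite -(fibre_ixK a) cE [RHS]mxE; congr (_ * _).
by rewrite -trE.
Qed.

(** In the chart x_i != 0 the base point is normalized to x_i = 1, and the chart coordinates of the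
    fibre serve as [y]. *)
Definition scroll_of p : 'rV[K]_N.+1 :=
  scroll_vec (\row_a hratio a (projT1 p) (base p)) (coords p).

Lemma hratio_row (i : 'I_2) (x : P1) :
  \row_a hratio a i x = (vec (Defs.repr x) 0 i)^-1 *: vec (Defs.repr x).
Proof. by apply/rowP => a; rewrite !mxE mulrC. Qed.

Lemma hratio_row_neq0 (i : 'I_2) (x : P1) : std_open i x ->
  \row_a hratio a i x != 0.
Proof.
by move=> xi; rewrite hratio_row scaler_eq0 invr_eq0 negb_or xi vec_neq0.
Qed.

Lemma scroll_of_neq0 p : scroll_of p <> 0.
Proof.
apply/eqP/scroll_vec_neq0 => //; last exact: coords_neq0.
by apply: hratio_row_neq0; apply: (dom_base p).
Qed.

Definition scroll_pt p : punctured K N :=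
  exist _ (scroll_of p) (@scroll_of_neq0 p).

Definition scroll_map (z : hirzebruch K n) : PN :=
  pcls (scroll_pt (Defs.repr z)).

(** Passing between charts multiplies [w] by 1/r and [y_e] by c r^(block_deg e - A). As block [e]
    has degree [block_deg e] in [w], it changes by c / r^A, a factor independent of [e]. *)
Lemma scroll_map_line p : scroll_map (line p) = pcls (scroll_pt p).
Proof.
apply/proj_eqP; set q := Defs.repr _.
have /same_line_eqP pq : line q = line p by apply: cls_repr.
have := pq => /hirzebruch_same_lineP[bqp [c c0 cE]].
set r := hratio _ _ _ in cE.
have r0 : r != 0.
  by apply: hratio_neq0; [rewrite bqp; apply: (dom_base p)|apply: (dom_base q)].
exists (c / r ^+ A); first by rewrite mulf_neq0 ?invr_eq0 ?expf_neq0.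
change (scroll_of p = (c / r ^+ A) *: scroll_of q); rewrite /scroll_of.
have -> : \row_a hratio a (projT1 p) (base p) =
    r^-1 *: \row_a hratio a (projT1 q) (base q).
  apply/rowP => a; rewrite !mxE /r -bqp /hratio.
  have hq : hcoord (projT1 q) (base q) != 0 := dom_base q.
  have hp : hcoord (projT1 p) (base q) != 0 by rewrite bqp; apply: (dom_base p).
  by field; rewrite hq.
rewrite (@scroll_vec_scale _ _ _ ((c / r ^+ A) *: coords q)) ?invr_eq0 //.
  exact: scroll_vec_scaler.
move=> e; rewrite mxE cE.
have rD : r ^+ block_deg e = r ^+ (block_deg e - A) * r ^+ A.
  by rewrite -exprD subnK //; case: e => /=; lia.
by rewrite exprVn rD; field; rewrite !expf_neq0.
Qed.

(** Arbitrary homogeneous coordinates of the base point may replace the normalized ones of a chart: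
    division of [v] by its i-th entry is undone by powers of that entry in the fibre coordinates.
    [scroll_of_vec] is the reverse passage. *)
Lemma scroll_vec_of (v : punctured K 1) (y : 'rV[K]_2) : y != 0 ->
  exists2 p : nonzero_charts E, base p = pcls v &
    scroll_of p = scroll_vec (vec v) y.
Proof.
move=> y0; have /rV0Pn[i vi] := vec_neq0 v.
set u : 'rV[K]_2 := \row_a (vec v 0 i ^+ block_deg (a == 1) * y 0 a).
have u0 : u <> 0.
  apply/eqP; have /rV0Pn[a ya] := y0; apply/rV0Pn; exists a.
  by rewrite mxE mulf_neq0 // expf_neq0.
have xi : std_open i (pcls v) by apply/std_open_cls.
exists (existT _ i (exist _ (pcls v, u) (conj xi u0))) => //.
rewrite /scroll_of /= -[base _]/(pcls v) -[coords _]/u.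
have -> : \row_a hratio a i (pcls v) = (vec v 0 i)^-1 *: vec v.
  by apply/rowP => a; rewrite !mxE hratio_cls mulrC.
apply: scroll_vec_scale; first by rewrite invr_eq0.
move=> e; rewrite mxE fibre_ix_eq1 exprVn mulrA mulVf ?mul1r //.
exact: expf_neq0.
Qed.

Lemma scroll_of_vec p (v : punctured K 1) : base p = pcls v ->
  exists2 y, y != 0 & scroll_of p = scroll_vec (vec v) y.
Proof.
move=> bp; set i := projT1 p.
have vi : vec v 0 i != 0 by apply/std_open_cls; rewrite -bp;
  apply: (dom_base p).
exists (\row_a ((vec v 0 i)^-1 ^+ block_deg (a == 1) * coords p 0 a)).
  have /rV0Pn[a ya] := coords_neq0 p; apply/rV0Pn; exists a.
  by rewrite mxE mulf_neq0 // expf_neq0 // invr_eq0.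
rewrite /scroll_of bp.
have -> : \row_a hratio a i (pcls v) = (vec v 0 i)^-1 *: vec v.
  by apply/rowP => a; rewrite !mxE hratio_cls mulrC.
apply: scroll_vec_scale => [|e]; first by rewrite invr_eq0.
by rewrite mxE fibre_ix_eq1.
Qed.

Lemma scroll_map_fibreP (x : punctured K 1) (v : punctured K N) :
  (scroll_map @` [set z : hirzebruch K n | bundle_proj z = pcls x]) (pcls v) <->
  exists2 y : 'rV[K]_2, y != 0 & vec v = scroll_vec (vec x) y.
Proof.
split=> [[z /= zx]|[y y0 vE]].
  rewrite -(cls_repr z) scroll_map_line => /proj_eqP[c c0 vE].
  have [y y0 yE] := scroll_of_vec zx.
  exists (c *: y); first by rewrite scaler_eq0 negb_or c0.
  by rewrite scroll_vec_scaler -yE.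
have [p bp pE] := scroll_vec_of x y0; exists (line p).
  by rewrite /= bundle_proj_cls.
rewrite scroll_map_line; apply/proj_eqP; exists 1;
  rewrite ?oner_neq0 // scale1r vE.
by rewrite -pE.
Qed.

Lemma range_scroll_mapP (v : punctured K N) :
  range scroll_map (pcls v) <->
  exists w y : 'rV[K]_2, [/\ w != 0, y != 0 & vec v = scroll_vec w y].
Proof.
split=> [[z _ zv]|[w [y [/eqP w0 y0 vE]]]].
  have [x xE] : exists x, bundle_proj z = pcls x.
    by exists (Defs.repr (bundle_proj z)); rewrite cls_repr.
  have /scroll_map_fibreP[y y0 vE] : (scroll_map @` [set z : hirzebruch K n |
    bundle_proj z = pcls x]) (pcls v).
    by exists z.
  by exists (vec x), y; rewrite vec_neq0.
have /scroll_map_fibreP[z _ zv] : exists2 y : 'rV[K]_2, y != 0 &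
  vec v = scroll_vec (vec (exist _ w w0 : punctured K 1)) y by exists y.
by exists z.
Qed.

Lemma range_scroll_map_closed : zopen (~` range scroll_map : set PN).
Proof.
pose minor (t : bool * nat * (bool * nat)) : {mpoly K[N.+1]} :=
  let: (e, l, (e', l')) := t in
  'X_(coord_ix e l) * 'X_(coord_ix e' l'.+1) - 'X_(coord_ix e l.+1) *
    'X_(coord_ix e' l').
exists [set v | exists2 t, (t.1.2 < block_deg t.1.1)%N /\ (t.2.2 < block_deg
  t.2.1)%N &
                 peval (minor t) v != 0].
  exists [set h | exists2 t, (t.1.2 < block_deg t.1.1)%N /\ (t.2.2 < block_deg
    t.2.1)%N &
                  h = minor t] => v; split=> [[t tD tv]|[h [t tD ->] tv]].
    by exists (minor t) => //; exists t.
  by exists t.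
have minorE t v : peval (minor t) v = v 0 (coord_ix t.1.1 t.1.2) * v 0 (coord_ix
  t.2.1 t.2.2.+1)
    - v 0 (coord_ix t.1.1 t.1.2.+1) * v 0 (coord_ix t.2.1 t.2.2).
  by case: t => [[e l] [e' l']]; rewrite /peval /= mevalB !mevalM !mevalXU.
rewrite predeqE => v; split=> [nv|[t [tD tD'] /eqP tv] /range_scroll_mapP[w [y
  [w0 y0 vE]]]].
  apply: contrapT => noE; apply/nv/range_scroll_mapP/(minors_scroll_vec
    (vec_neq0 v)).
  move=> e l e' l' lD l'D; apply/eqP; rewrite -subr_eq0;
    apply/negPn/negP => ne0.
  apply: noE.
  by exists ((e, l), (e', l')) => //; rewrite minorE.
apply: tv; rewrite minorE -[sval v]/(vec v) vE; apply/eqP; rewrite subr_eq0.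
by apply/eqP/scroll_vec_minors.
Qed.

Lemma scroll_map_morphism : morphism scroll_map.
Proof.
have nP1 := nice_proj K 1; have nA := nice_affine K.
have nC : nice (nonzero_charts E) by apply: nice_nonzero_charts.
(* On lifts to the nonzero charts the map is given, chart by chart, by products of the regular
   functions x_a/x_i and the fibre coordinates. *)
suff mpt : morphism scroll_pt.
  apply/(morphism_onT _ (nice_quotient _ nC))/morphism_on_quotient.
  apply: (@morphism_on_eq K (nonzero_charts E) PN _ (cls (@proportional K N) \o
    scroll_pt)) => //.
    by move=> p _; rewrite /= scroll_map_line.
  apply: (@morphism_on_morphism K (nonzero_charts E) (punctured K N) PN).
  - exact: nice_punctured.
  - exact/morphism_onT.
  - exact: morphism_cls.
apply: morphism_coprod => i.
have nX : nice (nonzero_chart i) by apply/nice_subspace/nice_product.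
apply/morphism_onT => //; apply: morphism_on_subspace => //.
have oT := nice_openT nX.
have sv : morphism_on setT (sval : nonzero_chart i ->
  product P1 (affine_space K 2)).
  by apply/morphism_onT => //; apply/morphism_sval/nice_product.
have m1 : morphism_on setT (fst \o sval : nonzero_chart i -> P1).
  by apply: morphism_on_morphism sv (morphism_fst _ _) => //;
    apply: nice_product.
have m2 : morphism_on setT (snd \o sval : nonzero_chart i -> affine_space K 2).
  by apply: morphism_on_morphism sv (morphism_snd _ _) => //;
    apply: nice_product.
have rh a : regular (setT : set (nonzero_chart i))
    (hratio a i \o (fst \o sval)).
  apply: (@morphism_on_regular K _ P1 _ _ (std_open i)) => //.
  - exact: std_open_open.
  - exact: regular_hratio.
  - by move=> [[x u] [/= xi _]] _.
have rc a : regular (setT : set (nonzero_chart i))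
    ((fun u : 'rV[K]_2 => u 0 a) \o (snd \o sval)).
  apply: (@morphism_on_regular K _ (affine_space K 2) _ _ setT) => //.
  - exact: nice_openT.
  - exact: regular_coord.
apply: morphism_on_affine => // j.
have -> : (fun x : nonzero_chart i =>
  ((sval \o (scroll_pt \o existT _ i)) x : 'rV_N.+1) 0 j)
  = fun x => (snd (sval x)) 0 (fibre_ix (block j)) *
     hratio 0 i (fst (sval x)) ^+ (block_deg (block j) - offset j) *
     hratio 1 i (fst (sval x)) ^+ offset j.
  by apply/funext => x; rewrite /= /scroll_of !mxE.
apply: nice_mul => //; last exact/nice_exp/(rh 1).
by apply: nice_mul => //; [apply: rc|exact/nice_exp/(rh 0)].
Qed.

(** * Local inverses and the closed embedding *)

Implicit Types (j : 'I_2) (e : bool).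

Definition coord_pair (j : 'I_2) e (v : 'rV[K]_N.+1) : 'rV[K]_2 :=
  \row_a v 0 (coord_ix e (j * (block_deg e).-1 + a)).

Definition corners (j : 'I_2) (v : 'rV[K]_N.+1) : 'rV[K]_2 :=
  \row_a v 0 (coord_ix (a == 1) (j * block_deg (a == 1))).

Lemma coord_pair_corner j e v : coord_pair j e v 0 j = v 0 (coord_ix e (j *
  block_deg e)).
Proof.
rewrite mxE; congr (v 0 (coord_ix e _)); have := block_deg_gt0 e.
by elim/ord2P: j => D1; rewrite ?mul0n // !mul1n addn1 prednK.
Qed.

Lemma corners_fibre_ix j e v : corners j v 0 (fibre_ix e) = v 0 (coord_ix e (j *
  block_deg e)).
Proof. by rewrite mxE fibre_ix_eq1. Qed.

Let one_neq0 m : const_mx 1 <> 0 :> 'rV[K]_m.+1.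
Proof. by move/rowP/(_ 0)/eqP; rewrite !mxE oner_eq0. Qed.

Let pt1 : punctured K 1 := exist _ (const_mx 1) (@one_neq0 1).

Let chart1_in (j : 'I_2) : std_open j (pcls pt1 : P1) /\ const_mx 1 <> 0 :>
  'rV[K]_2.
Proof.
split; last exact: one_neq0.
by apply/std_open_cls; rewrite mxE oner_neq0.
Qed.

(** Meaningful where the corner (j, e) of [v] is nonzero: the pair at that corner gives the base
    point, and the corners of both blocks, free of [w] when x_j = 1, give the fibre coordinates in
    chart [j]. Elsewhere the default points built from [const_mx 1] may appear. *)
Definition inv_chart (j : 'I_2) e (v : 'rV[K]_N.+1) : nonzero_charts E :=
  existT _ j (to_sub (exist _ (pcls pt1, const_mx 1) (chart1_in j)
                        : @nonzero_chart _ _ _ E j)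
                (pcls (to_sub pt1 (coord_pair j e v)), corners j v)).

Lemma coord_pair_neq0 j e v : v 0 (coord_ix e (j * block_deg e)) != 0 ->
  coord_pair j e v <> 0.
Proof. by move=> ve; apply/eqP/rV0Pn; exists j; rewrite coord_pair_corner. Qed.

Lemma inv_chart_in j e v : v 0 (coord_ix e (j * block_deg e)) != 0 ->
  std_open j (pcls (to_sub pt1 (coord_pair j e v)) : P1) /\ corners j v <> 0.
Proof.
move=> ve; split; last by apply/eqP/rV0Pn; exists (fibre_ix e);
  rewrite corners_fibre_ix.
apply/std_open_cls; rewrite /vec sval_to_sub; last exact: coord_pair_neq0.
by rewrite coord_pair_corner.
Qed.

Lemma base_inv_chart j e v : v 0 (coord_ix e (j * block_deg e)) != 0 ->
  base (inv_chart j e v) = pcls (to_sub pt1 (coord_pair j e v)).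
Proof. move=> ve; exact: (congr1 fst (@sval_to_sub _ (product P1 (affine_space K
  2))
  [set p | std_open j p.1 /\ p.2 <> 0] _ (_, _) (inv_chart_in ve))). Qed.

Lemma coords_inv_chart j e v : v 0 (coord_ix e (j * block_deg e)) != 0 ->
  coords (inv_chart j e v) = corners j v.
Proof. move=> ve; exact: (congr1 snd (@sval_to_sub _ (product P1 (affine_space K
  2))
  [set p | std_open j p.1 /\ p.2 <> 0] _ (_, _) (inv_chart_in ve))). Qed.

Lemma line_inv_chart_scroll_of j e c p : c != 0 ->
  scroll_of p 0 (coord_ix e (j * block_deg e)) != 0 ->
  line (inv_chart j e (c *: scroll_of p)) = line p.
Proof.
move=> c0 pe; have cpe : (c *: scroll_of p) 0 (coord_ix e (j * block_deg e)) !=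
  0.
  by rewrite mxE mulf_neq0.
symmetry; apply/same_line_eqP/hirzebruch_same_lineP.
have hE a : (\row_a hratio a (projT1 p) (base p)) 0 a = hratio a (projT1 p)
  (base p).
  by rewrite mxE.
have := pe; rewrite scroll_vec_corner hE mulf_eq0 negb_or => /andP[ue re].
have r0 : hratio j (projT1 p) (base p) != 0.
  by move: re; rewrite expf_eq0 block_deg_gt0.
rewrite base_inv_chart // coords_inv_chart //; split.
  rewrite -{1}(cls_repr (base p)); apply/proj_eqP.
  set w := Defs.repr (base p); set d := coords p 0 (fibre_ix e) in ue *.
  (* The pair at the corner is c d r^(D-1) times the row of ratios x_a/x_i, with r = x_j/x_i and D
     the block degree; dividing by x_i passes to the row of representatives. *)
  exists (c * (d * hratio j (projT1 p) (base p) ^+ (block_deg e).-1) / vec w 0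
    (projT1 p)).
    have wi : vec w 0 (projT1 p) != 0 := dom_base p.
    by rewrite !mulf_neq0 ?invr_eq0 ?expf_neq0.
  rewrite /vec sval_to_sub; last exact: coord_pair_neq0.
  apply/rowP => a; rewrite [RHS]mxE [LHS]mxE mxE scroll_vec_pair !hE -/d.
  by rewrite {2}/hratio /hcoord -/w -!mulrA [_ / _]mulrC.
(* The corner of block e' is c y_e' r^(block_deg e'); splitting off r^A leaves the transition factor
   from the chart of [p] to chart [j]. *)
exists (c * hratio j (projT1 p) (base p) ^+ A).
  by rewrite mulf_neq0 // expf_neq0.
move=> e'; rewrite corners_fibre_ix mxE scroll_vec_corner hE /=.
have -> : hratio j (projT1 p) (base p) ^+ block_deg e' =
    hratio j (projT1 p) (base p) ^+ (block_deg e' - A) * hratio j (projT1 p)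
      (base p) ^+ A.
  by rewrite -exprD subnK //; case: e' => /=; lia.
by ring.
Qed.

Lemma line_inv_chart_scale j e c v : c != 0 ->
  v 0 (coord_ix e (j * block_deg e)) != 0 ->
  line (inv_chart j e (c *: v)) = line (inv_chart j e v).
Proof.
move=> c0 ve; have cve : (c *: v) 0 (coord_ix e (j * block_deg e)) != 0 by
  rewrite mxE mulf_neq0.
apply/same_line_eqP/hirzebruch_same_lineP;
  rewrite !base_inv_chart // !coords_inv_chart //.
split.
  apply/proj_eqP; exists c^-1; first by rewrite invr_eq0.
  rewrite /vec !sval_to_sub; try exact: coord_pair_neq0.
  by apply/rowP => a; rewrite !mxE mulrA mulVf // mul1r.
exists c^-1 => [|e']; first by rewrite invr_eq0.
rewrite !corners_fibre_ix mxE /= /hratio divff ?expr1n ?mulr1; last first.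
  by have := cve => /inv_chart_in[].
by rewrite mulrA mulVf // mul1r.
Qed.

Lemma inv_chart_morphism_on j e :
  morphism_on [set v : punctured K N | vec v 0 (coord_ix e (j * block_deg e)) !=
    0]
    (inv_chart j e \o (@vec K N) : punctured K N -> nonzero_charts E).
Proof.
set U := (X in morphism_on X); have oU : zopen U by apply: zopen_vec_neq0.
have nP := nice_punctured K; have nA := nice_affine K; have nPr := nice_proj K.
have rv i : regular U (fun v : punctured K N => vec v 0 i).
  by apply: nice_regularS (regular_vec i) => //; apply: nice_openT.
apply: (@morphism_on_morphism K (punctured K N) (@nonzero_chart _ _ _ E j)
  (nonzero_charts E)
  U (fun v : punctured K N => to_sub (exist _ (pcls pt1,
    const_mx 1) (chart1_in j)
                        : @nonzero_chart _ _ _ E j)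
                (pcls (to_sub pt1 (coord_pair j e (vec v))),
                  corners j (vec v)))).
- by apply/nice_subspace/nice_product.
- apply: (@morphism_on_to_sub K (punctured K N) (product P1 (affine_space K 2))
    _ _ _
    (fun v : punctured K N => (pcls (to_sub pt1 (coord_pair j e (vec v))) : P1,
      corners j (vec v)))).
  + by [].
  + exact: nice_product.
  + by move=> v; apply: inv_chart_in.
  + apply: (@morphism_on_product K (punctured K N) P1 (affine_space K 2) U
      (fun v : punctured K N => pcls (to_sub pt1 (coord_pair j e (vec v)))) (fun
        v : punctured K N => corners j (vec v))).
    * by [].
    * apply: (@morphism_on_morphism K (punctured K N) (punctured K 1) P1 U
        (fun v : punctured K N => to_sub pt1 (coord_pair j e (vec v))));
          [exact: nP| |exact: morphism_cls].
      apply: (@morphism_on_to_sub K (punctured K N) (affine_space K 2) _ _ _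
        (fun v : punctured K N => coord_pair j e (vec v))) => //.
        by move=> v; apply: coord_pair_neq0.
      apply: morphism_on_affine => // a.
      by under eq_fun do rewrite mxE; apply: rv.
    * apply: morphism_on_affine => // a.
      by under eq_fun do rewrite mxE; apply: rv.
- exact: morphism_existT.
Qed.

Implicit Types je : 'I_2 * bool.

(** Some x_j and some y_e are nonzero, so one of the four corners is too. *)
Lemma scroll_map_corner z : exists je : 'I_2 * bool,
  std_open (coord_ix je.2 (je.1 * block_deg je.2)) (scroll_map z).
Proof.
rewrite -(cls_repr z) scroll_map_line; set p := Defs.repr z.
have /rV0Pn[a ya] := coords_neq0 p.
have /rV0Pn[j wj] : \row_a hratio a (projT1 p) (base p) != 0.
  by apply: hratio_row_neq0; apply: (dom_base p).
exists (j, a == 1); apply/std_open_cls;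
  rewrite /vec /= scroll_vec_corner fibre_ixK.
by rewrite mulf_neq0 // expf_neq0.
Qed.

Definition scroll_map_inv (je : 'I_2 * bool) (x : PN) : hirzebruch K n :=
  line (inv_chart je.1 je.2 (vec (Defs.repr x))).

Lemma scroll_map_invK je z : std_open (coord_ix je.2 (je.1 * block_deg je.2))
  (scroll_map z) ->
  scroll_map_inv je (scroll_map z) = z.
Proof.
rewrite /scroll_map_inv -{1 3}(cls_repr z) => pz.
have /proj_eqP[c c0 vE] : pcls (scroll_pt (Defs.repr z)) = pcls (Defs.repr
  (scroll_map z)).
  by rewrite cls_repr.
move: pz; rewrite scroll_map_line => /std_open_cls pe.
by rewrite vE line_inv_chart_scroll_of.
Qed.

Lemma scroll_map_inv_morphism_on je :
  morphism_on (std_open (coord_ix je.2 (je.1 * block_deg je.2))) (scroll_map_inv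
    je).
Proof.
case: je => j e; apply: morphism_on_quotient.
have -> : cls (@proportional K N) @^-1` std_open (coord_ix e (j * block_deg e))
  =
    [set v : punctured K N | vec v 0 (coord_ix e (j * block_deg e)) != 0].
  by rewrite predeqE => v; apply: std_open_cls.
apply: (@morphism_on_eq K (punctured K N) (hirzebruch K n) _
  (cls (@same_line _ _ _ E) \o (inv_chart j e \o (@vec K N)))).
- exact: nice_punctured.
- move=> v /= ve; rewrite /scroll_map_inv /=.
  have /proj_eqP[c c0 vE] : pcls v = pcls (Defs.repr (pcls v)) by rewrite
    cls_repr.
  by rewrite vE (line_inv_chart_scale c0 ve).
- apply: (@morphism_on_morphism K (punctured K N) (nonzero_charts E)).
  + exact/nice_nonzero_charts/nice_proj.
  + exact: inv_chart_morphism_on.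
  + exact: morphism_cls.
Qed.

Lemma scroll_map_closed_embedding : closed_embedding scroll_map.
Proof.
have nPN := nice_proj K N.
have nH : nice (hirzebruch K n).
  exact/nice_quotient/nice_nonzero_charts/nice_proj.
split; first exact: range_scroll_map_closed.
set f := (X in isomorphism X).
have scroll_map_preim (b : subspace (range scroll_map)) : exists z,
  scroll_map z = sval b.
  by case: b => b bP /=; case: bP => z _ zb; exists z.
(* A set-theoretic inverse obtained by choice; near each point it coincides with one of the local
   inverses, which also give injectivity. *)
pose g (b : subspace (range scroll_map)) := projT1 (cid (scroll_map_preim b)).
have gK b : scroll_map (g b) = sval b by rewrite /g; case: cid.
have fg b : f (g b) = b.
  by apply: eq_sig_hprop => [x p1 p2|]; [exact: Prop_irrelevance|exact: gK].
have scroll_map_inj z z' : scroll_map z = scroll_map z' -> z = z'.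
  have [je pz] := scroll_map_corner z => zz';
    rewrite -(scroll_map_invK pz) zz' scroll_map_invK //.
  by rewrite -zz'.
split; first exact/morphism_onT/morphism_on_subspace/morphism_onT/scroll_map_morphism.
exists g; split=> //; last by move=> z; apply: scroll_map_inj; rewrite gK.
apply: morphism_subspace_local => // b.
have [je pz] := scroll_map_corner (g b).
exists (std_open (coord_ix je.2 (je.1 * block_deg je.2))), (scroll_map_inv je);
  split.
- by rewrite -gK.
- exact: scroll_map_inv_morphism_on.
- by move=> b'; rewrite -(gK b') => /scroll_map_invK.
Qed.

(** * Hilbert functions of the fibres and of the scroll *)

Lemma peval0 m (p : dhomog N.+1 K m) : (0 < m)%N -> peval p (0 : 'rV_N.+1) = 0.
Proof.
by move=> m0; rewrite -(scale0r 0) peval_scale expr0n gtn_eqF // mul0r.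
Qed.

(** With x fixed, the h-th coordinate is a constant times y_0 or y_1, so restrictions of forms are
    spanned by y_0^i y_1^(m-i). Positive m makes forms vanish at the origin, which the
    parametrization reaches but the cone over the fibre omits. *)
Lemma hilbert_function_fibre (x : punctured K 1) m : (0 < m)%N ->
  hilbert_function (scroll_map @` [set z : hirzebruch K n | bundle_proj z = pcls
    x]) m m.+1.
Proof.
move=> m_gt0; rewrite -[X in hilbert_function _ _ X](card_ord m.+1).
pose s (i : 'I_m.+1) := (U_(0%R) *+ i + U_(1%R) *+ (m - i) : 'X_{1..2})%MM.
have sE i : (s i 0%R = i) * (s i 1%R = m - i)%N.
  by rewrite !mnmDE !mulmnE !mnm1E /= !mul1n !mul0n addn0.
apply: (@hilbert_function_monomial K N m 2 _
  (fun h => vec x 0 0 ^+ (block_deg (block h) - offset h) * vec x 0 1 ^+ offset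
    h)
  (fun h => U_(fibre_ix (block h))%MM) _ s).
- have FE (u : 'I_2 -> K) (p : {mpoly K[N.+1]}) : p.@[fun h =>
    vec x 0 0 ^+ (block_deg (block h) - offset h) *
      vec x 0 1 ^+ offset h * \prod_(a < 2) u a ^+ U_(fibre_ix (block h))%MM a]
        =
      peval p (scroll_vec (vec x) (\row_a u a)).
    apply: meval_eq => h; rewrite !mxE mulrC mulrA; congr (_ * _ * _).
    rewrite (bigD1 (fibre_ix (block h))) //= mnm1E eqxx expr1 big1 ?mulr1 // =>
      a ne.
    by rewrite mnm1E eq_sym (negbTE ne).
  move=> p; split=> [p0 u|p0 v /scroll_map_fibreP[y y0 ->]]; last first.
    by have := p0 (fun a => y 0 a); rewrite FE;
      congr (peval _ (scroll_vec _ _) = _);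
      apply/rowP => a; rewrite mxE.
  rewrite FE; have [->|u0] := eqVneq (\row_a u a) 0;
    first by rewrite scroll_vec0r peval0.
  have G0 : scroll_vec (vec x) (\row_a u a) <> 0 by apply/eqP/scroll_vec_neq0 =>
    //; apply: vec_neq0.
  have := p0 (exist (fun v : 'rV[K]_N.+1 => v <> 0) _ G0); apply.
  by apply/scroll_map_fibreP; exists (\row_a u a).
- by move=> i i' ii'; apply: val_inj; rewrite /= -(sE i).1 ii' sE.
- move=> mo mo_m; have aE a : (\sum_(h < N.+1) U_(fibre_ix (block h)) *+ mo
    h)%MM a =
      (\sum_(h < N.+1) (fibre_ix (block h) == a) * mo h)%N.
    by rewrite mnm_sumE; apply: eq_bigr => h _; rewrite mulmnE mnm1E.
  have tot : ((\sum_(h < N.+1) (fibre_ix (block h) == 0%R) * mo h) +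
      (\sum_(h < N.+1) (fibre_ix (block h) == 1%R) * mo h) = mdeg mo)%N.
    rewrite mdegE -big_split; apply: eq_bigr => h _ /=.
    by case: (block h); rewrite /= ?mul0n ?mul1n ?addn0.
  have lt_i : (\sum_(h < N.+1) (fibre_ix (block h) == 0%R) * mo h < m.+1)%N.
    by rewrite ltnS -mo_m -tot leq_addr.
  exists (Ordinal lt_i); apply/mnmP => a; rewrite aE; elim/ord2P: a.
    by rewrite (sE _).1.
  by rewrite (sE _).2 /= -mo_m -tot addKn.
- move=> i; have /rV0Pn[a xa] := vec_neq0 x.
  (* The coefficients may vanish at x; using only the corners for a nonzero x_a keeps the
     coefficient of the monomial nonzero. *)
  pose c e := coord_ix e (a * block_deg e).
  have cD e : (a * block_deg e <= block_deg e)%N by elim/ord2P: a {xa c};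
    rewrite ?mul0n // mul1n.
  exists (U_(c false) *+ i + U_(c true) *+ (m - i))%MM; split.
  + by rewrite mdegD !mdegMn !mdeg1 !mul1n subnKC // -ltnS ltn_ord.
  + apply/prodf_neq0 => h _; rewrite mnmDE !mulmnE !mnm1E.
    have [<-|_] := eqVneq (c false) h; last have [<-|_] := eqVneq (c true) h.
    * rewrite expf_neq0 // block_coord_ix // offset_coord_ix //.
      elim/ord2P: a xa {c cD} => xa; first by rewrite subn0 expr0 mulr1
        expf_neq0.
      by rewrite mul1n subnn mul1r expf_neq0.
    * rewrite expf_neq0 // block_coord_ix // offset_coord_ix //.
      elim/ord2P: a xa {c cD} => xa; first by rewrite subn0 expr0 mulr1
        expf_neq0.
      by rewrite mul1n subnn mul1r expf_neq0.
    * by rewrite !mul0n expr0 oner_neq0.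
  + apply/mnmP => b; rewrite mnm_sumE.
    under eq_bigr do rewrite mulmnE mnmDE !mulmnE.
    rewrite /s mnmDE !mulmnE.
    under eq_bigr do rewrite mulnDr !mulnA.
    rewrite big_split /= -!big_distrl /=; congr (_ * _ + _ * _)%N.
      rewrite (bigD1 (c false)) //= (mnm1E (c false)) eqxx muln1 block_coord_ix
        // big1 ?addn0 // => h ne.
      by rewrite (mnm1E (c false)) eq_sym (negbTE ne) muln0.
    rewrite (bigD1 (c true)) //= (mnm1E (c true)) eqxx muln1 block_coord_ix //
      big1 ?addn0 // => h ne.
    by rewrite (mnm1E (c true)) eq_sym (negbTE ne) muln0.
Qed.

(** Greedy choice: one factor at a time is added from a block, absorbing as much of [t] as the block
    degree allows. *)
Lemma exists_monomial c0 c1 t : (t <= c0 * A + c1 * B)%N ->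
  exists mo : 'X_{1..N.+1},
    [/\ \sum_(h < N.+1) ~~ block h * mo h = c0,
        \sum_(h < N.+1) block h * mo h = c1 &
        \sum_(h < N.+1) offset h * mo h = t]%N.
Proof.
have addU (f : 'I_N.+1 -> nat) (mo : 'X_{1..N.+1}) h0 :
    (\sum_(h < N.+1) f h * (mo + U_(h0))%MM h = \sum_(h < N.+1) f h * mo h + f
      h0)%N.
  under eq_bigr do rewrite mnmDE mulnDr.
  rewrite big_split /=; congr (_ + _)%N.
  rewrite (bigD1 h0) //= mnm1E eqxx muln1 big1 ?addn0 // => h ne.
  by rewrite mnm1E eq_sym (negbTE ne) muln0.
have addix e (mo : 'X_{1..N.+1}) l : (l <= block_deg e)%N ->
    [/\ \sum_(h < N.+1) ~~ block h * (mo + U_(coord_ix e l))%MM h =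
          \sum_(h < N.+1) ~~ block h * mo h + ~~ e,
        \sum_(h < N.+1) block h * (mo + U_(coord_ix e l))%MM h =
          \sum_(h < N.+1) block h * mo h + e &
        \sum_(h < N.+1) offset h * (mo + U_(coord_ix e l))%MM h =
          \sum_(h < N.+1) offset h * mo h + l]%N.
  by move=> lD; rewrite !(addU (fun h => _)) block_coord_ix // offset_coord_ix.
elim: c1 c0 t => [|c1 IH] c0 t.
  elim: c0 t => [|c0 IH] t tD.
    exists 0%MM; split; rewrite big1 // => *; rewrite ?mnm0E ?muln0 //.
    by move: tD; rewrite leqn0 => /eqP.
  have [|mo [s0 s1 st]] := IH (t - minn t A)%N; first by lia.
  have [|s0' s1' st'] := addix false mo (minn t A); first exact: geq_minr.
  by exists (mo + U_(coord_ix false (minn t A)))%MM;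
    rewrite s0' s1' st' s0 s1 st /=; split; lia.
move=> tD; have [|mo [s0 s1 st]] := IH c0 (t - minn t B)%N; first by lia.
have [|s0' s1' st'] := addix true mo (minn t B); first exact: geq_minr.
by exists (mo + U_(coord_ix true (minn t B)))%MM;
  rewrite s0' s1' st' s0 s1 st /=; split; lia.
Qed.

(** The pair (i, t) stands for y_0^i y_1^(m-i) x_0^(d-t) x_1^t with d = iA + (m-i)B. *)
Let bidegree m : finType :=
  {i : 'I_m.+1 & 'I_(i * A + (m - i) * B).+1}.

(* Exponents of x_0, x_1 and of the two fibre coordinates. *)
Let exps (a b c d : nat) : 'X_{1..2 + 2} :=
  [multinom match split i with
            | inl t => if t == 0%R then a else b
            | inr t => if t == 0%R then c else d
            end | i < 2 + 2].

Lemma exps_lshift a b c d t :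
  exps a b c d (lshift 2 t) = if t == 0%R then a else b.
Proof. by rewrite mnmE (unsplitK (inl t)). Qed.

Lemma exps_rshift a b c d t :
  exps a b c d (rshift 2 t) = if t == 0%R then c else d.
Proof. by rewrite mnmE (unsplitK (inr t)). Qed.

Lemma exps_inj a b c d a' b' c' d' : exps a b c d = exps a' b' c' d' ->
  [/\ a = a', b = b', c = c' & d = d'].
Proof.
move=> e; split.
- by have := congr1 (fun f : 'X_{1..2 + 2} => f (lshift 2 0)) e;
    rewrite !exps_lshift.
- by have := congr1 (fun f : 'X_{1..2 + 2} => f (lshift 2 1)) e;
    rewrite !exps_lshift.
- by have := congr1 (fun f : 'X_{1..2 + 2} => f (rshift 2 0)) e;
    rewrite !exps_rshift.
- by have := congr1 (fun f : 'X_{1..2 + 2} => f (rshift 2 1)) e;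
    rewrite !exps_rshift.
Qed.

(** All coefficients of the parametrization are 1, so only exponents matter. [totE] and [degE]
    confine them to the index set, and [exists_monomial] reaches each of them. *)
Lemma hilbert_function_scroll m : (0 < m)%N ->
  hilbert_function (range scroll_map) m (\sum_(i < m.+1) (i * A + (m - i) *
    B).+1)%N.
Proof.
move=> m_gt0.
have -> : (\sum_(i < m.+1) (i * A + (m - i) * B).+1)%N = #|bidegree m|.
  rewrite card_tagged sumnE big_map big_enum /=.
  by apply: eq_bigr => i _; rewrite card_ord.
pose M (h : 'I_N.+1) := exps (block_deg (block h) - offset h) (offset h) (~~
  block h) (block h).
pose s (z : bidegree m) :=
  exps (tag z * A + (m - tag z) * B - tagged z) (tagged z) (tag z) (m - tag z).
have MoE (mo : 'X_{1..N.+1}) : (\sum_h M h *+ mo h)%MM =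
    exps (\sum_(h < N.+1) (block_deg (block h) - offset h) * mo h) (\sum_(h <
      N.+1) offset h * mo h)
         (\sum_(h < N.+1) ~~ block h * mo h) (\sum_(h < N.+1) block h * mo h).
  apply/mnmP => a; rewrite mnm_sumE mnmE; under eq_bigr do rewrite mulmnE mnmE.
  by case: (split a) => b; case: (b == 0).
have totE (mo : 'X_{1..N.+1}) :
    (\sum_(h < N.+1) ~~ block h * mo h + \sum_(h < N.+1) block h * mo h = mdeg
      mo)%N.
  rewrite mdegE -big_split; apply: eq_bigr => h _ /=.
  by case: (block h); rewrite /= ?mul0n ?mul1n ?addn0.
have degE (mo : 'X_{1..N.+1}) :
    (\sum_(h < N.+1) (block_deg (block h) - offset h) * mo h + \sum_(h < N.+1)
      offset h * mo h =
     (\sum_(h < N.+1) ~~ block h * mo h) * A + (\sum_(h < N.+1) block h * mo h)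
       * B)%N.
  rewrite !big_distrl -!big_split; apply: eq_bigr => h _ /=.
  have := offset_le h; case: (block h) => /= le; nia.
apply: (@hilbert_function_monomial K N m (2 + 2) _ (fun=> 1) M _ s).
- have FE (u : 'I_(2 + 2) -> K) (p : {mpoly K[N.+1]}) :
      p.@[fun h => 1 * \prod_(a < 2 + 2) u a ^+ M h a] =
      peval p (scroll_vec (\row_a u (lshift 2 a)) (\row_a u (rshift 2 a))).
    apply: meval_eq => h; rewrite !mxE mul1r big_split_ord /=.
    rewrite !big_ord_recl !big_ord0 /= !mulr1.
    have -> : lift ord0 ord0 = 1 :> 'I_2 by apply: val_inj.
    rewrite !exps_lshift !exps_rshift /= mulrC mulrA; congr (_ * _ * _).
    by case: (block h); rewrite /= expr0 expr1 ?mulr1 ?mul1r.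
  move=> p; split=> [p0 u|p0 v].
    rewrite FE; set w := \row_a _; set y := \row_a _.
    have [->|w0] := eqVneq w 0; first by rewrite scroll_vec0l peval0.
    have [->|y0] := eqVneq y 0; first by rewrite scroll_vec0r peval0.
    have G0 : scroll_vec w y <> 0 by apply/eqP/scroll_vec_neq0.
    have := p0 (exist (fun v : 'rV[K]_N.+1 => v <> 0) _ G0); apply.
    by apply/range_scroll_mapP; exists w, y.
  move=> /range_scroll_mapP[w [y [w0 y0 ->]]].
  have := p0 (fun a => match split a with inl b => w 0 b | inr b => y 0 b end).
  rewrite FE; congr (peval _ (scroll_vec _ _) = _); apply/rowP => a;
    rewrite mxE.
    by rewrite (unsplitK (inl a)).
  by rewrite (unsplitK (inr a)).
- move=> [i t] [i' t'] /exps_inj[/= _ tt' /val_inj ii' _].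
  by case: _ / ii' t' tt' => t' /val_inj ->.
- move=> mo mo_m; have lt_i : (\sum_(h < N.+1) ~~ block h * mo h < m.+1)%N.
    by rewrite ltnS -mo_m -totE leq_addr.
  have mi : (m - \sum_(h < N.+1) ~~ block h * mo h = \sum_(h < N.+1) block h *
    mo h)%N.
    by rewrite -mo_m -totE addKn.
  have lt_t : (\sum_(h < N.+1) offset h * mo h <
      (Ordinal lt_i * A + (m - Ordinal lt_i) * B).+1)%N.
    by rewrite ltnS /= mi -degE leq_addl.
  exists (Tagged (fun i : 'I_m.+1 =>
    'I_(i * A + (m - i) * B).+1) (Ordinal lt_t)).
  by rewrite /s /= MoE mi -degE addnK.
- move=> [i t]; have [|mo [s0 s1 st]] := @exists_monomial i (m - i) t.
    by rewrite -ltnS ltn_ord.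
  exists mo; split.
  + by rewrite -totE s0 s1 subnKC // -ltnS ltn_ord.
  + by apply/prodf_neq0 => h _; rewrite expr1n oner_neq0.
  + have := degE mo; rewrite s0 s1 st => /(canRL (addnK _)) dE.
    by rewrite MoE s0 s1 st dE.
Qed.

End Scroll.

(** * Degrees from Hilbert polynomials, and the conclusion *)

Lemma has_degree_fibre (K : closedFieldType) N (Z : set (proj_space K N)) :
  (forall m, (0 < m)%N -> hilbert_function Z m m.+1) -> has_degree Z 1.
Proof.
move=> hZ; exists ('X + 1%:P); split; last first.
  have sz : size ('X + 1%:P : {poly rat}) = 2 by rewrite size_XaddC.
  by rewrite lead_coefDl ?size_polyC ?size_polyX // lead_coefX sz mul1r.
exists 1 => m m_gt0; exists m.+1; first exact: hZ.
by rewrite !hornerE -natr1.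
Qed.

Lemma has_degree_scroll (K : closedFieldType) N (Z : set (proj_space K N)) A B :
  (0 < A)%N ->
  (forall m, (0 < m)%N ->
    hilbert_function Z m (\sum_(i < m.+1) (i * A + (m - i) * B).+1)%N) ->
  has_degree Z (A + B).
Proof.
move=> A_gt0 hZ; pose c : rat := (A + B)%:R / 2.
have c0 : c != 0 by rewrite mulf_neq0 // pnatr_eq0 -lt0n addn_gt0 A_gt0.
(* This is (m + 1) + (A + B) m(m + 1)/2 expanded in powers of m. Positivity of A keeps the top
   coefficient nonzero, so the list of coefficients is already normalized. *)
pose P := Poly [:: 1; c + 1; c].
have PE : P = [:: 1; c + 1; c] :> seq rat by apply: (@PolyK _ 0).
exists P; split; last first.
  by rewrite lead_coefE PE /= /c divfK.
exists 1 => m m_gt0; eexists; first exact: hZ.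
have sumE : (2 * \sum_(i < m.+1) (i * A + (m - i) * B).+1 =
    2 * m.+1 + (A + B) * (m * m.+1))%N.
  have gauss : (2 * \sum_(i < m.+1) i = m * m.+1)%N.
    rewrite mul2n -addnn {1}(reindex_inj rev_ord_inj) -big_split /=.
    under eq_bigr => i _ do rewrite subSS subnK ?leq_ord //.
    by rewrite sum_nat_const card_ord mulnC.
  have gauss' : (\sum_(i < m.+1) (m - i) = \sum_(i < m.+1) i)%N.
    by rewrite [RHS](reindex_inj rev_ord_inj); apply: eq_bigr => i _;
      rewrite /= subSS.
  under eq_bigr do rewrite -addn1.
  rewrite !big_split /= -!big_distrl /= gauss' sum_nat_const card_ord muln1.
  by rewrite -gauss; set S := (\sum_(i < _) _)%N; ring.
apply: (mulfI (_ : 2 != 0 :> rat)) => //.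
have -> : 2 * (\sum_(i < m.+1) (i * A + (m - i) * B).+1)%:R =
    (2 * \sum_(i < m.+1) (i * A + (m - i) * B).+1)%:R :> rat by rewrite natrM.
by rewrite sumE horner_Poly /= /c !(natrD, natrM) -natr1; field.
Qed.

Theorem theorem3p10 (R : realType) (n k : nat) (hkn : (n < k)%N) :
  exists phi : hirzebruch R[i] n -> proj_space R[i] (2 * k - n + 1)%N,
    rational_scroll phi /\ has_degree (range phi) (2 * k - n)%N.
Proof.
(* The block degrees are A = k - n and B = k; here n < k gives the positivity of A. *)
have A_gt0 : (0 < k - n)%N by rewrite subn_gt0.
have BE : k = (k - n + n)%N by rewrite subnK // ltnW.
have NE : (2 * k - n + 1 = (k - n + k).+1)%N by lia.
exists (scroll_map A_gt0 BE NE); split; last first.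
  rewrite [X in has_degree _ X](_ : _ = (k - n + k)%N); last by lia.
  by apply: has_degree_scroll => // m; apply: hilbert_function_scroll.
split; last split.
- by exists id; split; [|exists id].
- exact: scroll_map_closed_embedding.
- move=> c; apply: has_degree_fibre => m m_gt0.
  by rewrite -(cls_repr c); apply: hilbert_function_fibre.
Qed.
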